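(* Let $M=M(S^2;\frac{q_1}{p_1},\frac{q_2}{p_2},\frac{q_3}{p_3})$ be a Seifert manifold with $e(M)\neq0$ which has no exceptional abelian characters. Then the character scheme $\mathcal{X}(M)$ is reduced.
   Context: $M(S^2;\frac{q_1}{p_1},\frac{q_2}{p_2},\frac{q_3}{p_3})$ ($(p_i,q_i)$ coprime, $p_i\ge1$) is the closed Seifert manifold obtained from $S_{0,3}\times S^1$ by gluing solid tori whose meridians are $p_ic_i+q_ih_i$; $e(M)=\sum_iq_i/p_i$; $\pi_1(M)=\langle c_1,c_2,c_3,h\mid [c_i,h]=1=c_i^{p_i}h^{q_i},\ c_1c_2c_3=1\rangle$. $\mathcal{X}(M)=\mathrm{Hom}(\pi_1(M),\mathrm{SL}_2(\mathbb{C}))/\!/\mathrm{SL}_2(\mathbb{C})$ is the character scheme, reduced if its coordinate ring has no nonzero nilpotents. An abelian character is the trace of a diagonal representation; it is exceptional if it is the trace of a representation $\rho$ with $\rho(h)=\pm I$ and $\rho(c_i)\neq\pm I$ for $i=1,2,3$. *)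

(* Defs.v *)
From HB Require Import structures.
From mathcomp Require Import all_boot all_algebra.
From mathcomp Require Import reals complex mpoly.
Set Implicit Arguments. Unset Strict Implicit. Unset Printing Implicit Defensive.
Import GRing.Theory Num.Theory.
Local Open Scope ring_scope.

(* Generators of pi_1(M) are indexed by nat: 0,1,2 = c_1,c_2,c_3 ; 3 = h. *)

Section Seifert.
Variable F : fieldType.

(* integer power of a 2x2 matrix; negative powers use the adjugate, which is
   the inverse for matrices of determinant 1 (the only case used). *)
Definition zpow {T : comNzRingType} (A : 'M[T]_2) (z : int) : 'M[T]_2 :=
  match z with
  | Posz n => A ^+ n
  | Negz n => (\adj A) ^+ n.+1
  end.

Notation P := {mpoly F[16]}.

Definition vidx (j : nat) (a b : 'I_2) : 'I_16 := inord (4 * j + 2 * a + b).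
Definition Xv (j : nat) : 'M[P]_2 := \matrix_(a, b) 'X_(vidx j a b).

Definition mx_entries {T : Type} (A : 'M[T]_2) : seq T :=
  [seq A a b | a <- enum 'I_2, b <- enum 'I_2].

Definition rel_gens (p : 'I_3 -> nat) (q : 'I_3 -> int) : seq P :=
  [seq \det (Xv j) - 1 | j <- iota 0 4]
  ++ flatten [seq mx_entries (Xv i *m Xv 3 - Xv 3 *m Xv i) | i : 'I_3 <- enum 'I_3]
  ++ flatten [seq mx_entries (Xv i ^+ p i *m zpow (Xv 3) (q i) - 1%:M)
             | i : 'I_3 <- enum 'I_3]
  ++ mx_entries (Xv 0 *m Xv 1 *m Xv 2 - 1%:M).

Definition in_ideal (gs : seq P) (f : P) : Prop :=
  exists cs : seq P, f = \sum_(i < size gs) cs`_i * gs`_i.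

Definition conj_mx (g : 'M[F]_2) (j : nat) : 'M[P]_2 :=
  map_mx (fun c => c%:MP) g *m Xv j *m map_mx (fun c => c%:MP) (invmx g).

Definition conj_sub (g : 'M[F]_2) : 16.-tuple P :=
  [tuple conj_mx g (k %/ 4) (inord ((k %% 4) %/ 2)) (inord (k %% 2)) | k < 16].

(* f represents an element of the SL_2-invariant subring of F[Hom] = P / I *)
Definition invariant_class (gs : seq P) (f : P) : Prop :=
  forall g : 'M[F]_2, \det g = 1 -> in_ideal gs (comp_mpoly (conj_sub g) f - f).

(* The character scheme X(M) = Spec (P/I)^{SL_2} is reduced: every nilpotent
   invariant class is zero. *)
Definition character_scheme_reduced (p : 'I_3 -> nat) (q : 'I_3 -> int) : Prop :=
  forall f : P, invariant_class (rel_gens p q) f ->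
    (exists n : nat, in_ideal (rel_gens p q) (f ^+ n)) ->
    in_ideal (rel_gens p q) f.

Definition is_rep (p : 'I_3 -> nat) (q : 'I_3 -> int) (rho : nat -> 'M[F]_2)
  : Prop :=
  [/\ forall j, (j < 4)%N -> \det (rho j) = 1,
      forall i : 'I_3, rho i *m rho 3%N = rho 3%N *m rho i,
      forall i : 'I_3, rho i ^+ p i *m zpow (rho 3%N) (q i) = 1%:M
    & rho 0%N *m rho 1%N *m rho 2%N = 1%:M].

Definition word_eval (rho : nat -> 'M[F]_2) (w : seq ('I_4 * bool)) : 'M[F]_2 :=
  foldr (fun (x : 'I_4 * bool) acc => (if x.2 then rho x.1 else invmx (rho x.1)) *m acc) 1%:M w.

Definition character (rho : nat -> 'M[F]_2) : seq ('I_4 * bool) -> F :=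
  fun w => \tr (word_eval rho w).

Definition is_diagonal_rep p q (rho : nat -> 'M[F]_2) : Prop :=
  is_rep p q rho /\ forall j, (j < 4)%N -> is_diag_mx (rho j).

Definition exceptional_rep p q (rho : nat -> 'M[F]_2) : Prop :=
  [/\ is_rep p q rho, rho 3%N = 1%:M \/ rho 3%N = - 1%:M
    & forall i : 'I_3, rho i <> 1%:M /\ rho i <> - 1%:M].

Definition has_exceptional_abelian_character p q : Prop :=
  exists rho rho' : nat -> 'M[F]_2,
    [/\ is_diagonal_rep p q rho, exceptional_rep p q rho'
      & character rho =1 character rho'].

End Seifert.

Definition euler_number (p : 'I_3 -> nat) (q : 'I_3 -> int) : rat :=
  \sum_(i < 3) (q i)%:~R / (p i)%:R.

(* Main.v *)
(* In the ring of functions on Hom(pi_1(M), SL_2), the universal representation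
   satisfies polynomial equations that split it into pieces on which an
   invariant function is constant. To show that a nilpotent invariant f is
   zero, pick (by Zorn) an ideal maximal among those not containing f; the
   quotient B is connected in the sense that comaximal u, v with u v = 0 cannot
   both be nonzero, so an element of B annihilated by a separable polynomial
   over F is a constant.
   The trace of h is annihilated by the separable polynomial U_N(X) (X^2 - 4),
   where U_N is a Chebyshev polynomial and N = |p_1 p_2 p_3 e(M)|. If tr h is a
   constant different from 2, -2, then all matrices commute with a matrix with
   distinct constant eigenvalues and become simultaneously diagonal with
   constant entries. If tr h = 2, -2, then the traces of the c_i are constants
   r_i up to nilpotents. If some r_i = 2, -2, everything commutes again.
   Otherwise the absence of exceptional abelian characters says that
   r_1^2 + r_2^2 + r_3^2 - r_1 r_2 r_3 - 4, which is minus the determinant of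
   c_1 c_2 - c_2 c_1, is invertible; this forces h to be scalar and the traces
   to be constant. In each case the universal representation is intertwined with a
   constant one by matrices whose determinants generate the unit ideal, so f is
   constant on B, hence zero there: a contradiction. *)

Require Import Defs.
From HB Require Import structures.
From mathcomp Require Import all_boot all_algebra.
From mathcomp Require Import reals complex mpoly.
From mathcomp Require Import ring_quotient generic_quotient separable ring.
From mathcomp Require boolp classical_sets.
Set Implicit Arguments. Unset Strict Implicit. Unset Printing Implicit Defensive.
Import GRing.Theory Num.Theory.
Local Open Scope ring_scope.

(** * Ideals, quotients and connected quotients *)

Definition is_ideal {P : comNzRingType} (I : P -> Prop) : Prop :=
  [/\ I 0, forall x y, I x -> I y -> I (x + y) & forall a x, I x -> I (a * x)].

(** Equivalently, 0 and 1 are the only idempotents: if [u * v = 0], then [a * u] is idempotent. The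
    zero ring counts as connected. *)
Definition connected (B : comNzRingType) : Prop :=
  forall a b u v : B, a * u + b * v = 1 -> u * v = 0 -> u = 0 \/ v = 0.

Section Quotient.
Variables (P : comNzRingType) (I : P -> Prop).
Hypotheses (idI : is_ideal I) (I1 : ~ I 1).

Definition mem_ideal : {pred P} := fun x => boolp.asbool (I x).

Lemma mem_idealP x : reflect (I x) (x \in mem_ideal).
Proof. exact: boolp.asboolP. Qed.

Lemma mem_ideal_closed : idealr_closed mem_ideal.
Proof.
case: idI => I0 ID IM; split.
- exact/mem_idealP.
- by apply/negP => /mem_idealP.
- by move=> a x y /mem_idealP Ix /mem_idealP Iy; apply/mem_idealP/ID => //; apply: IM.
Qed.

HB.instance Definition _ := isIdealr.Build P mem_ideal mem_ideal_closed.

Lemma quotient_exists :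
  exists (B : comNzRingType) (pi : {rmorphism P -> B}),
    (forall b, exists x, pi x = b) /\ (forall x, pi x = 0 <-> I x).
Proof.
pose B : comNzRingType := {ideal_quot mem_ideal}.
pose pi : {rmorphism P -> B} := \pi_({ideal_quot mem_ideal})%qT.
exists B, pi; split=> [b|x].
  by exists (repr b); exact: reprK.
rewrite -(rmorph0 pi); split=> [/eqP|/mem_idealP Ix].
  by rewrite /pi /= -Quotient.idealrBE subr0 => /mem_idealP.
by apply/eqP; rewrite /pi /= -Quotient.idealrBE subr0.
Qed.
End Quotient.

(** Modulo an ideal maximal among those that contain [I] and avoid [f], the image of [f] is a
    multiple of every nonzero element. If [u] and [v] were nonzero, [f = (a * u + b * v) * f] would
    be a multiple of [u * v = 0]. *)
Lemma connected_quotient_exists {P : comNzRingType} {I : P -> Prop} {f : P} :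
  is_ideal I -> ~ I f ->
  exists (B : comNzRingType) (pi : {rmorphism P -> B}),
    [/\ connected B, forall x, I x -> pi x = 0 & pi f <> 0].
Proof.
move=> idI If.
(* [Zorn_bigcup] also asks about the empty chain, whose union is empty; adjoining [I] turns that
   case into the ideal [I] itself. *)
pose U (A : classical_sets.set P) := fun x => I x \/ A x.
pose good (A : classical_sets.set P) := is_ideal (U A) /\ ~ U A f.
have [F Fgood Ftot | A [[idA Af] Amax]] := @classical_sets.Zorn_bigcup P good.
  have pair x y : U (classical_sets.bigcup F id) x ->
      U (classical_sets.bigcup F id) y ->
      (I x /\ I y) \/ exists2 X, F X & U X x /\ U X y.
    move=> [Ix|[X FX Xx]] [Iy|[Y FY Yy]]; first by left.
    - by right; exists Y => //; split; [left | right].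
    - by right; exists X => //; split; [right | left].
    - right; have [XY|YX] := Ftot _ _ FX FY.
        by exists Y => //; split; right => //; apply: XY.
      by exists X => //; split; right => //; apply: YX.
  have lift X x : F X -> U X x -> U (classical_sets.bigcup F id) x.
    by move=> FX [Ix|Xx]; [left | right; exists X].
  have [I0 ID IM] := idI.
  split; last first.
    move=> Uf; have [[]//|[X FX [Xf _]]] := pair f f Uf Uf.
    by have [_] := Fgood _ FX; apply.
  split; first by left.
    move=> x y Ux Uy; have [[Ix Iy]|[X FX [Xx Xy]]] := pair x y Ux Uy.
      by left; apply: ID.
    by apply: (lift X) => //; have [[_ + _] _] := Fgood _ FX; apply.
  move=> a x Ux; have [[Ix _]|[X FX [Xx _]]] := pair x x Ux Ux.
    by left; apply: IM.
  by apply: (lift X) => //; have [[_ _ +] _] := Fgood _ FX; apply.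
have [A0 AD AM] := idA.
have A1 : ~ U A 1 by move=> /(AM f); rewrite mulr1.
have [B [pi [pi_surj piE]]] := quotient_exists idA A1.
exists B, pi; split; last 2 first.
- by move=> x Ix; apply/piE; left.
- by move/piE.
(* Adjoining [w] strictly enlarges the maximal ideal, so the larger ideal [A'] must contain [f]. *)
have gen w : pi w <> 0 -> exists c, pi f = pi (c * w).
  move=> piw; apply: boolp.contrapT => nof.
  pose A' := fun x => exists c, U A (x - c * w).
  have UA' x : A' x -> U A' x by right.
  have A'U x : U A' x -> A' x.
    by case=> // Ix; exists 0; rewrite mul0r subr0; left.
  have AA' x : U A x -> A' x by move=> Ux; exists 0; rewrite mul0r subr0.
  apply: (Amax A').
    split; first by move=> x Ax; apply: AA'; right.
    move=> sub; have Aw : A w by apply: sub; exists 1; rewrite mul1r subrr.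
    by apply: piw; apply/piE; right.
  split; last first.
    move=> /A'U [c cf]; apply: nof; exists c; apply/eqP.
    by rewrite -subr_eq0 -rmorphB; apply/eqP/piE.
  split.
  - exact/UA'/AA'.
  - move=> x y /A'U [c cx] /A'U [d dy]; apply: UA'; exists (c + d).
    by rewrite mulrDl opprD addrACA; apply: AD.
  - move=> a x /A'U [c cx]; apply: UA'; exists (a * c).
    by rewrite -mulrA -mulrBr; apply: AM.
move=> a b u v; have [a' <-] := pi_surj a; have [b' <-] := pi_surj b.
have [u' <-] := pi_surj u; have [v' <-] := pi_surj v => auv uv.
apply: boolp.contrapT => /boolp.not_orP [u0 v0].
have [c cu] := gen u' u0; have [d dv] := gen v' v0.
have : pi f <> 0 by move/piE.
apply; rewrite -[pi f]mul1r -auv mulrDl {1}dv cu !rmorphM.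
transitivity ((pi a' * pi d + pi b' * pi c) * (pi u' * pi v')); first ring.
by rewrite uv mulr0.
Qed.

(** * Connected rings and Chebyshev polynomials *)

Section Comaximal.
Variable B : comNzRingType.
Implicit Types x y z : B.

Definition comaximal x y : Prop := exists a b, a * x + b * y = 1.

Lemma comaximalC x y : comaximal x y -> comaximal y x.
Proof. by move=> [a [b ab]]; exists b, a; rewrite addrC. Qed.

Lemma comaximalM x y z : comaximal x y -> comaximal x z -> comaximal x (y * z).
Proof.
move=> [a [b ab]] [c [d cd]]; exists (a * (c * x + d * z) + b * y * c), (b * d).
rewrite -[RHS]mulr1 -{1}ab -[1 in RHS]cd; ring.
Qed.

Lemma comaximal1 x : comaximal x 1.
Proof. by exists 0, 1; rewrite mul0r add0r mul1r. Qed.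

Lemma comaximalX x y m n : comaximal x y -> comaximal (x ^+ m) (y ^+ n).
Proof.
move=> xy; have {xy} : comaximal x (y ^+ n).
  elim: n => [|n IH]; first by rewrite expr0; apply: comaximal1.
  by rewrite exprS; apply: comaximalM.
move=> /comaximalC xy; apply: comaximalC.
elim: m => [|m IH]; first by rewrite expr0; apply: comaximal1.
by rewrite exprS; apply: comaximalM.
Qed.

End Comaximal.

Section Chebyshev.

(* Normalized so that, with x = z + 1/z, chebU x n = (z^n - z^-n) / (z - 1/z)
   and chebT x n = z^n + z^-n. *)
Fixpoint chebU {S : comNzRingType} (x : S) (n : nat) : S :=
  match n with
  | 0 => 0
  | n1.+1 => match n1 with
             | 0 => 1
             | n2.+1 => x * chebU x n1 - chebU x n2
             end
  end.

Definition chebT {S : comNzRingType} (x : S) (n : nat) : S :=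
  chebU x n.+1 *+ 2 - x * chebU x n.

Lemma chebUSS (S : comNzRingType) (x : S) n :
  chebU x n.+2 = x * chebU x n.+1 - chebU x n.
Proof. by []. Qed.

Lemma chebU_morph (S S' : comNzRingType) (h : {rmorphism S -> S'}) x n :
  h (chebU x n) = chebU (h x) n.
Proof.
suff: h (chebU x n) = chebU (h x) n /\ h (chebU x n.+1) = chebU (h x) n.+1.
  by case.
elim: n => [|n [IH1 IH2]]; first by rewrite /= rmorph0 rmorph1.
by split=> //; rewrite !chebUSS rmorphB rmorphM IH1 IH2.
Qed.

Lemma chebT_morph (S S' : comNzRingType) (h : {rmorphism S -> S'}) x n :
  h (chebT x n) = chebT (h x) n.
Proof. by rewrite /chebT rmorphB rmorphMn rmorphM !chebU_morph. Qed.

Variable T : comNzRingType.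
Implicit Types x : T.

(** The quadratic form is preserved by the recursion step (a, b) -> (x a - b, a). *)
Lemma chebU_pell x n :
  chebU x n.+1 ^+ 2 - x * chebU x n.+1 * chebU x n + chebU x n ^+ 2 = 1.
Proof.
elim: n => [|n IH]; first by rewrite /=; ring.
rewrite -[RHS]IH chebUSS; move: (chebU x n.+1) (chebU x n) => a b; ring.
Qed.

(** With x = z + 1/z this is (z^n + z^-n)^2 - 4 = (z^n - z^-n)^2. *)
Lemma chebT_pell x n : chebT x n ^+ 2 - 4 = (x ^+ 2 - 4) * chebU x n ^+ 2.
Proof.
transitivity (chebT x n ^+ 2 - 4 *
  (chebU x n.+1 ^+ 2 - x * chebU x n.+1 * chebU x n + chebU x n ^+ 2)).
  by rewrite chebU_pell mulr1.
by rewrite /chebT; ring.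
Qed.

(** The identity comes from applying z d/dz to (z - 1/z) U_n = z^n - z^-n; it serves to exclude
    multiple roots. *)
Lemma chebU_deriv n :
  ('X ^+ 2 - 4) * (chebU 'X n)^`() = n%:R * chebT 'X n - 'X * chebU 'X n :> {poly T}.
Proof.
pose Q n := ('X ^+ 2 - 4) * (chebU 'X n)^`()
   = n%:R * chebT 'X n - 'X * chebU 'X n :> {poly T}.
suff: Q n /\ Q n.+1 by case.
elim: n => [|n [IH1 IH2]].
  have d1 : (1 : {poly T})^`() = 0 by rewrite -polyC1 derivC.
  by split; rewrite /Q /chebT /= ?d1 ?linear0; ring.
split=> //; rewrite /Q chebUSS derivB derivM derivX.
transitivity (('X ^+ 2 - 4) * chebU 'X n.+1
  + 'X * (('X ^+ 2 - 4) * (chebU 'X n.+1)^`())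
  - ('X ^+ 2 - 4) * (chebU 'X n)^`() : {poly T}); first ring.
rewrite IH1 IH2 /chebT !chebUSS.
rewrite -[n.+2]addn2 -[n.+1]addn1 !natrD; ring.
Qed.

End Chebyshev.

Section Roots.
Variables (F : numClosedFieldType) (B : comNzRingType) (i : {rmorphism F -> B}).

Lemma comaximal_const (s : B) (x y : F) :
  x != y -> comaximal (s - i x) (s - i y).
Proof.
move=> xy; exists (i (y - x)^-1), (- i (y - x)^-1).
transitivity (i ((y - x)^-1 * (y - x))).
  by rewrite rmorphM rmorphB; ring.
by rewrite mulVf ?rmorph1 // subr_eq0 eq_sym.
Qed.

Lemma inj_const (x y : F) : i x = i y -> x = y.
Proof. exact: fmorph_inj. Qed.

Lemma nilpotent_const (x : F) m : i x ^+ m = 0 -> x = 0.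
Proof.
rewrite -rmorphXn -(rmorph0 i) => /inj_const/eqP.
by rewrite expf_eq0 => /andP[_ /eqP].
Qed.

Hypothesis connB : connected B.

(** Distinct constants differ by a unit, so the factors are pairwise comaximal, and so are their
    powers. The exponent [m] serves elements that are roots only up to nilpotents. *)
Lemma connected_root (s : B) (rs : seq F) m : uniq rs ->
  (\prod_(r <- rs) (s - i r)) ^+ m = 0 -> exists2 r, r \in rs & (s - i r) ^+ m = 0.
Proof.
elim: rs => [_|r rs IH] /=.
  by rewrite big_nil expr1n => /eqP; rewrite oner_eq0.
move=> /andP[r_rs uniq_rs]; rewrite big_cons exprMn => prod0.
have: comaximal (s - i r) (\prod_(r <- rs) (s - i r)).
  rewrite big_seq; elim/big_rec: _ => [|x z x_rs IHz]; first exact: comaximal1.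
  apply: comaximalM => //; apply: comaximal_const.
  by apply: contraNneq r_rs => ->.
move=> /(comaximalX m m) [a [b ab]].
have [?|rest0] := connB ab prod0; first by exists r; rewrite ?mem_head.
have [x x_rs x0] := IH uniq_rs rest0; exists x => //.
by rewrite in_cons x_rs orbT.
Qed.

Lemma chebT_root_sq (x : F) n : (x ^+ 2 == 4) || (chebU x n == 0) ->
  chebT x n ^+ 2 = 4.
Proof.
move=> x0; apply/eqP; rewrite -subr_eq0 chebT_pell.
by case/orP: x0 => /eqP ->; rewrite ?subrr ?mul0r // expr0n mulr0.
Qed.

Lemma horner_chebU (x : F) n : (chebU 'X n).[x] = chebU x n.
Proof.
by rewrite -/(horner_eval x _) chebU_morph /= horner_evalE hornerX.
Qed.

Lemma horner_chebT (x : F) n : (chebT 'X n).[x] = chebT x n.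
Proof.
by rewrite -/(horner_eval x _) chebT_morph /= horner_evalE hornerX.
Qed.

Lemma chebU_deriv_root (x : F) n :
  (x ^+ 2 - 4) * (chebU 'X n)^`().[x] = n%:R * chebT x n - x * chebU x n.
Proof.
have := congr1 (fun p => p.[x]) (chebU_deriv F n).
have horner_nat k : (k%:R : {poly F}).[x] = k%:R by rewrite -polyC_natr hornerC.
by rewrite hornerM !hornerD !hornerN !hornerM hornerX !horner_nat horner_chebT
  horner_chebU.
Qed.

(** At x = 2 or -2 the derivative identity reads x U_n = n T_n, where T_n^2 = 4 and n is nonzero in
    characteristic 0. *)
Lemma chebU_ramified_neq0 (x : F) n : (0 < n)%N -> x ^+ 2 = 4 -> chebU x n != 0.
Proof.
move=> n0 x4; apply/negP => /eqP u0.
have := chebU_deriv_root x n; rewrite x4 subrr u0 mul0r mulr0 subr0 => /eqP.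
rewrite eq_sym mulf_eq0 pnatr_eq0 eqn0Ngt n0 /= => /eqP T0.
have := @chebT_root_sq x n; rewrite x4 eqxx T0 expr0n => /(_ isT) /eqP.
by rewrite eq_sym pnatr_eq0.
Qed.

(** For n > 0 its roots in a closed field are the z + 1/z with z^(2n) = 1; the second factor
    supplies 2 and -2, which U_n misses. *)
Definition chebW {S : comNzRingType} (x : S) n := chebU x n * (x ^+ 2 - 4).

Lemma chebW_morph (S S' : comNzRingType) (h : {rmorphism S -> S'}) x n :
  h (chebW x n) = chebW (h x) n.
Proof. by rewrite /chebW rmorphM rmorphB rmorphXn rmorph_nat chebU_morph. Qed.

Lemma horner_chebW (x : F) n : (chebW 'X n).[x] = chebW x n.
Proof.
by rewrite -/(horner_eval x _) chebW_morph /= horner_evalE hornerX.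
Qed.

(** At a root of U_n the derivative is n T_n with T_n^2 = 4; at 2 and -2 it is 2 x U_n. *)
Lemma chebW_separable n : (0 < n)%N ->
  coprimep (chebW 'X n) (chebW 'X n : {poly F})^`().
Proof.
move=> n0; apply/(@Pdiv.ClosedField.coprimepP F) => x.
rewrite /root horner_chebW => Wx.
have -> : (chebW 'X n : {poly F})^`() =
    (chebU 'X n)^`() * ('X ^+ 2 - 4) + chebU 'X n * ('X *+ 2).
  by rewrite /chebW derivM derivB derivXn -[4](polyC_natr F 4) derivC subr0 expr1.
rewrite hornerD !hornerM hornerMn horner_chebU hornerD hornerXn hornerN.
rewrite -[4](polyC_natr F 4) hornerC hornerX mulrC chebU_deriv_root.
move: Wx; rewrite mulf_eq0 subr_eq0 => /orP[/eqP u0|/eqP x4].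
  have T4 : chebT x n ^+ 2 = 4 by apply: chebT_root_sq; rewrite u0 eqxx orbT.
  rewrite u0 mul0r mulr0 subr0 addr0 mulf_neq0 ?pnatr_eq0 -?lt0n //.
  by apply: contra_eq_neq T4 => ->; rewrite expr0n eq_sym pnatr_eq0.
have T4 : chebT x n ^+ 2 = 4 by apply: chebT_root_sq; rewrite x4 eqxx.
have := chebU_deriv_root x n; rewrite x4 subrr mul0r => /esym/eqP.
rewrite subr_eq0 => /eqP ->; rewrite subrr add0r.
have -> : chebU x n * (x *+ 2) = (x * chebU x n) *+ 2 by rewrite mulrnAr mulrC.
rewrite mulrn_eq0 negb_or /= mulf_neq0 ?chebU_ramified_neq0 //.
by apply: contra_eq_neq x4 => ->; rewrite expr0n eq_sym pnatr_eq0.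
Qed.

Lemma separable_root_nilpotent (s : B) (P : {poly F}) m : coprimep P P^`() ->
  (map_poly i P).[s] ^+ m = 0 -> exists2 r, root P r & (s - i r) ^+ m = 0.
Proof.
move=> sep Ps; have [rs Prs] := closed_field_poly_normal P.
have P0 : P != 0.
  by apply: contraTneq sep => ->; rewrite deriv0 coprimep0 -size_poly_eq1 size_poly0.
have lc0 : lead_coef P != 0 by rewrite lead_coef_eq0.
have uniq_rs : uniq rs.
  rewrite -separable_prod_XsubC unlock; move: sep; rewrite Prs derivZ.
  by rewrite coprimepZl // coprimepZr.
have Pprod : (map_poly i P).[s] = i (lead_coef P) * \prod_(r <- rs) (s - i r).
  rewrite {1}Prs map_polyZ hornerZ rmorph_prod horner_prod; congr (_ * _).
  by apply: eq_bigr => r _; rewrite /= map_polyXsubC hornerXsubC.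
have [|r r_rs r0] := @connected_root s rs m uniq_rs.
  set pr := \prod_(r <- rs) _ in Pprod *; set l := lead_coef _ in lc0 Pprod.
  have -> : pr = i l^-1 * (i l * pr) by rewrite mulrA -rmorphM mulVf // rmorph1 mul1r.
  by rewrite -Pprod exprMn Ps mulr0.
by exists r => //; rewrite Prs rootZ // root_prod_XsubC.
Qed.

Lemma chebW_root_nilpotent (s : B) n m : (0 < n)%N -> chebW s n ^+ m = 0 ->
  exists2 r, chebW r n = 0 & (s - i r) ^+ m = 0.
Proof.
move=> n0 Ws; have [|r] := separable_root_nilpotent (s := s) (m := m) (chebW_separable n0).
  pose h : {rmorphism {poly F} -> {poly B}} := map_poly i.
  pose h' : {rmorphism {poly B} -> B} := horner_eval s.
  rewrite -[X in X ^+ _]/(h' (h (chebW 'X n))) (chebW_morph h) (chebW_morph h').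
  by rewrite /h /h' /= map_polyX horner_evalE hornerX.
by rewrite /root horner_chebW => /eqP Wr; exists r.
Qed.

Lemma chebW_root (s : B) n : (0 < n)%N -> chebW s n = 0 ->
  exists2 r, chebW r n = 0 & s = i r.
Proof.
move=> n0 Ws; have [|r Wr] := @chebW_root_nilpotent s n 1 n0; first by rewrite expr1.
by rewrite expr1 => /eqP; rewrite subr_eq0 => /eqP; exists r.
Qed.

Lemma power_root (s : B) (c : F) n : (0 < n)%N -> c != 0 -> s ^+ n = i c ->
  exists2 r, r ^+ n = c & s = i r.
Proof.
move=> n0 c0 sn.
have sep : coprimep ('X^n - c%:P) ('X^n - c%:P)^`().
  apply/(@Pdiv.ClosedField.coprimepP F) => x; rewrite /root !hornerE subr_eq0 => /eqP xn.
  rewrite derivB derivC subr0 derivXn hornerMn hornerXn mulrn_eq0 negb_or -lt0n n0 /=.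
  apply/negP => /eqP xn1; move: c0; rewrite -xn -(prednK n0) exprS xn1 mulr0.
  by rewrite eqxx.
have [|r] := separable_root_nilpotent (s := s) (m := 1) sep.
  rewrite rmorphB rmorphXn /= map_polyX map_polyC /=.
  by rewrite hornerD hornerN hornerXn hornerC sn subrr expr1.
rewrite expr1 /root !hornerE subr_eq0 => /eqP rn /eqP; rewrite subr_eq0 => /eqP.
by exists r.
Qed.

End Roots.

(** * Two by two matrices *)

Section Matrix2.
Variable S : comNzRingType.
Implicit Types A B X : 'M[S]_2.

Lemma sum2E (f : 'I_2 -> S) : \sum_k f k = f 0 + f 1.
Proof.
rewrite big_ord_recl big_ord_recl big_ord0 addr0.
by congr (f _ + f _); apply: val_inj.
Qed.

Lemma ord2P (k : 'I_2) : k = 0 \/ k = 1.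
Proof. by case: k => [[|[|]]] // ?; [left | right]; apply: val_inj. Qed.

Lemma matrix2P A B :
  [/\ A 0 0 = B 0 0, A 0 1 = B 0 1, A 1 0 = B 1 0 & A 1 1 = B 1 1] -> A = B.
Proof.
move=> [AB00 AB01 AB10 AB11]; apply/matrixP => j k.
by case: (ord2P j) => ->; case: (ord2P k) => ->.
Qed.

Lemma mul2E A B j k : (A * B) j k = A j 0 * B 0 k + A j 1 * B 1 k.
Proof. by rewrite mxE sum2E. Qed.

Lemma tr2E A : \tr A = A 0 0 + A 1 1. Proof. exact: sum2E. Qed.

Lemma det2E A : \det A = A 0 0 * A 1 1 - A 0 1 * A 1 0.
Proof.
rewrite (expand_det_row _ 0) sum2E /cofactor !det_mx11 !mxE /= !expr0 !expr1.
have -> : lift 0 0 = 1 :> 'I_2 by apply: val_inj.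
have -> : lift 1 0 = 0 :> 'I_2 by apply: val_inj.
ring.
Qed.

Lemma adj2E A : \adj A = (\tr A)%:M - A.
Proof.
have l0 : lift 0 0 = 1 :> 'I_2 by apply: val_inj.
have l1 : lift 1 0 = 0 :> 'I_2 by apply: val_inj.
rewrite tr2E; apply: matrix2P; rewrite !mxE /cofactor !det_mx11 !mxE ?l0 ?l1 /=.
by split; rewrite ?mulr0n ?mulr1n; ring.
Qed.

Definition entry2E := (mul2E, tr2E, det2E).

Lemma cayley2 A : A * A = \tr A *: A - (\det A)%:M.
Proof.
by apply: matrix2P; rewrite !entry2E !mxE /= mulr1n mulr0n; split; ring.
Qed.

Lemma SL2_exp A n : \det A = 1 -> A ^+ n.+1 = chebU (\tr A) n.+1 *: A - (chebU (\tr A) n)%:M.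
Proof.
move=> dA; elim: n => [|n IH].
  by rewrite expr1 scale1r raddf0 subr0.
rewrite exprS IH mulrBr -scalerAr cayley2 dA chebUSS scalerBl scalerBr scalerA.
rewrite -[(chebU _ n)%:M]scalemx1 -scalerAr mulr1 scale_scalar_mx mulr1.
by rewrite [chebU _ _ * _]mulrC addrAC.
Qed.

Lemma adj2_unit A : \det A = 1 -> A * \adj A = 1 /\ \adj A * A = 1.
Proof. by move=> dA; rewrite -!mulmxE mul_mx_adj mul_adj_mx dA. Qed.

Lemma SL2_mulI A : \det A = 1 -> injective ( *%R A).
Proof.
move=> dA X Y AXY; have [_ adjA] := adj2_unit dA.
by rewrite -[X]mul1r -adjA -mulrA AXY mulrA adjA mul1r.
Qed.

(* The coordinates of the traceless part of A. *)
Definition tl A (k : 'I_3) : S := [:: A 0 1; A 1 0; A 0 0 - A 1 1]`_k.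

Lemma ord3P (k : 'I_3) : [\/ k = 0, k = 1 | k = 2].
Proof.
by case: k => [[|[|[|]]]] // ?; [constructor 1 | constructor 2 | constructor 3];
  apply: val_inj.
Qed.

Lemma tl_scale A (u v : S) k : tl (u *: A - v%:M) k = u * tl A k.
Proof. by case: (ord3P k) => ->; rewrite /tl /= !mxE /= ?mulr1n ?mulr0n; ring. Qed.

Lemma tl_eq0 A : (forall k, tl A k = 0) -> A = (A 0 0)%:M.
Proof.
move=> A0; have := (A0 0, A0 1, A0 2); rewrite /tl /= => -[[A01 A10]] /eqP.
rewrite subr_eq0 => /eqP A11.
by apply: matrix2P; rewrite !mxE /= ?mulr1n ?mulr0n.
Qed.

Lemma disc2E A : \tr A ^+ 2 - 4 * \det A = tl A 2 ^+ 2 + 4 * tl A 0 * tl A 1.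
Proof. by rewrite !entry2E /tl /=; ring. Qed.

(** The entries of [A * B - B * A] are, up to sign, the minors of the two traceless parts: the
    bracket of sl_2 is a cross product. *)
Lemma tl_comm A B : A * B = B * A -> forall k l, tl A k * tl B l = tl A l * tl B k.
Proof.
move=> AB; have e j k := congr1 (fun X : 'M_2 => X j k) AB.
have := (e 0 0, e 0 1, e 1 0); rewrite /= !mul2E => -[[e00 e01] e10].
have z00 : A 0 1 * B 1 0 = A 1 0 * B 0 1.
  apply/eqP; move/eqP: e00; rewrite -subr_eq0 => /eqP e00.
  by rewrite -subr_eq0 -e00; apply/eqP; ring.
have z01 : A 0 1 * (B 0 0 - B 1 1) = (A 0 0 - A 1 1) * B 0 1.
  apply/eqP; move/eqP: e01; rewrite -subr_eq0 => /eqP e01.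
  by rewrite -subr_eq0 -oppr_eq0 -e01; apply/eqP; ring.
have z10 : A 1 0 * (B 0 0 - B 1 1) = (A 0 0 - A 1 1) * B 1 0.
  apply/eqP; move/eqP: e10; rewrite -subr_eq0 => /eqP e10.
  by rewrite -subr_eq0 -e10; apply/eqP; ring.
by move=> k l; case: (ord3P k) => ->; case: (ord3P l) => ->; rewrite /tl /=.
Qed.

Lemma comm_tl (x : S) A B :
  (forall k l, x * (tl A k * tl B l - tl A l * tl B k) = 0) ->
  x *: (A * B) = x *: (B * A).
Proof.
move=> AB; have := (AB 0 1, AB 0 2, AB 1 2); rewrite /tl /= => -[[z0 z1] z2].
apply/eqP; rewrite -subr_eq0; apply/eqP; apply: matrix2P; rewrite !mxE -/(mulmx _ _) !sum2E.
split.
- by rewrite -z0; ring.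
- by rewrite -[RHS]oppr0 -z1; ring.
- by rewrite -z2; ring.
- by rewrite -[RHS]oppr0 -z0; ring.
Qed.

(** Over a field, matrices commuting with a nonscalar one commute with each other. Over a ring,
    multiplication by [tl H k] makes the traceless parts of [A] and [B] multiples of that of [H]. *)
Lemma tl_centralizer A B H k : A * H = H * A -> B * H = H * B ->
  tl H k *: (A * B) = tl H k *: (B * A).
Proof.
move=> AH BH; apply: comm_tl => j l.
transitivity (tl A j * tl H k * tl B l - tl A l * tl H k * tl B j); first ring.
rewrite (tl_comm AH j k) (tl_comm AH l k).
transitivity (tl A k * (tl B l * tl H j - tl B j * tl H l)); first ring.
by rewrite (tl_comm BH l j) subrr mulr0.
Qed.

End Matrix2.

Lemma mul_map_mx2 (S S' : comNzRingType) (h : {rmorphism S -> S'}) (X Y : 'M[S]_2) :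
  map_mx h X * map_mx h Y = map_mx h (X * Y).
Proof. by rewrite -!mulmxE map_mxM. Qed.

Lemma exp_map_mx2 (S S' : comNzRingType) (h : {rmorphism S -> S'}) (X : 'M[S]_2) n :
  map_mx h X ^+ n = map_mx h (X ^+ n).
Proof.
by elim: n => [|n IH]; rewrite ?expr0 ?map_mx1 // !exprS IH mul_map_mx2.
Qed.

(** * Representations over a connected ring *)

Lemma mulr_interleave (R : nzRingType) (x0 x1 x2 h0 h1 h2 : R) :
  h0 * x1 = x1 * h0 -> h0 * x2 = x2 * h0 -> h1 * x2 = x2 * h1 ->
  (x0 * h0) * (x1 * h1) * (x2 * h2) = (x0 * x1 * x2) * (h0 * h1 * h2).
Proof.
move=> c01 c02 c12.
by rewrite -!mulrA (mulrA h1 x2) c12 -(mulrA x2) (mulrA h0 x1) c01 -(mulrA x1)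
  (mulrA h0 x2) c02 -(mulrA x2).
Qed.

Section Representations.
Variables p a b : 'I_3 -> nat.

(* Here q j = a j - b j, which avoids negative powers of H. *)
Definition seifert_rep (S : comNzRingType) (C : 'I_3 -> 'M[S]_2) (H : 'M[S]_2) : Prop :=
  [/\ (forall j, \det (C j) = 1) /\ \det H = 1,
      forall j, C j * H = H * C j,
      forall j, C j ^+ p j * H ^+ a j = H ^+ b j
    & C 0 * C 1 * C 2 = 1].

Definition weighted (d : 'I_3 -> nat) : nat :=
  (d 0%R * (p 1%R * p 2%R) + d 1%R * (p 0%R * p 2%R) + d 2%R * (p 0%R * p 1%R))%N.
(** With q = a - b, the difference of the weighted sums is p_0 p_1 p_2 e(M). Subtraction on [nat] is
    truncated, so the sum of both differences is its absolute value. *)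
Definition euler_order := ((weighted a - weighted b) + (weighted b - weighted a))%N.

Lemma seifert_rep_morph (S S' : comNzRingType) (h : {rmorphism S -> S'}) C H :
  seifert_rep C H -> seifert_rep (fun j => map_mx h (C j)) (map_mx h H).
Proof.
move=> [[dC dH] CH CpH C012].
split.
- by split=> *; rewrite det_map_mx ?dC ?dH rmorph1.
- by move=> j; rewrite !mul_map_mx2 CH.
- by move=> j; rewrite !exp_map_mx2 mul_map_mx2 CpH.
- by rewrite !mul_map_mx2 C012 map_mx1.
Qed.

(** Raise [C 0 * C 1 * C 2 = 1] to the power p_0 p_1 p_2, distribute it over the commuting factors,
    and trade each [C j ^+ p j] for a power of [H]. *)
Lemma central_order (S : comNzRingType) (C : 'I_3 -> 'M[S]_2) H :
  seifert_rep C H -> (forall j k, C j * C k = C k * C j) -> H ^+ euler_order = 1.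
Proof.
move=> [[dC dH] CH CpH C012] CC.
have Hcan n : injective ( *%R (H ^+ n)).
  apply: SL2_mulI; elim: n => [|n IH]; first exact: det1.
  by rewrite exprS det_mulmx dH IH mul1r.
pose P := (p 0%R * (p 1%R * p 2%R))%N.
have CP : C 0 ^+ P * C 1 ^+ P * C 2 ^+ P = 1.
  have cm : GRing.comm (C 0 * C 1) (C 2) by apply/commr_sym/commrM; apply: CC.
  by rewrite -(exprMn_comm _ (CC 0 1)) -(exprMn_comm _ cm) C012 expr1n.
have CPn j n : C j ^+ (p j * n) * H ^+ (a j * n) = H ^+ (b j * n).
  rewrite !exprM -CpH exprMn_comm //.
  by apply/commrX/commr_sym/commrX/commr_sym/CH.
have CHX j m n : C j ^+ m * H ^+ n = H ^+ n * C j ^+ m.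
  by apply/commrX/commr_sym/commrX/commr_sym/CH.
have HAB : H ^+ weighted a = H ^+ weighted b.
  rewrite -[LHS]mul1r -CP /weighted !exprD -!CPn.
  have -> : (p 0%R * (p 1%R * p 2%R) = P)%N by [].
  have -> : (p 1%R * (p 0%R * p 2%R) = P)%N by rewrite /P mulnCA.
  have -> : (p 2%R * (p 0%R * p 1%R) = P)%N by rewrite /P mulnC mulnA.
  by rewrite mulr_interleave.
have cancel m n : (m <= n)%N -> H ^+ m = H ^+ n -> H ^+ (n - m) = 1.
  by move=> mn Hmn; apply: (Hcan m); rewrite -exprD subnKC // mulr1.
rewrite /euler_order; case: (leqP (weighted a) (weighted b)) => ab.
  by have /eqP -> := ab; rewrite add0n; apply: cancel.
have /eqP -> := ltnW ab; rewrite addn0; apply: cancel => //; exact: ltnW.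
Qed.

Variables (B : comNzRingType) (C : 'I_3 -> 'M[B]_2) (H : 'M[B]_2).
Hypothesis rep : seifert_rep C H.

(* Modulo the annihilator of a coordinate of the traceless part of H, the C j
   lie in the centralizer of a nonscalar matrix and hence commute. *)
Lemma chebU_annihilates k l :
  chebU (\tr H) euler_order * tl H k * tl H l = 0.
Proof.
have [[dC dH] CH _ _] := rep.
pose I x := x * tl H k = 0.
have idI : is_ideal I.
  split=> [|x y|c x]; rewrite /I; first exact: mul0r.
    by move=> x0 y0; rewrite mulrDl x0 y0 addr0.
  by move=> x0; rewrite -mulrA x0 mulr0.
case: (boolp.pselect (I 1)) => [|I1]; first by rewrite /I mul1r => ->; rewrite mulr0 mul0r.
have [B' [pi [_ piE]]] := quotient_exists idI I1.
have piC i j : map_mx pi (C i) * map_mx pi (C j) = map_mx pi (C j) * map_mx pi (C i).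
  apply/matrixP => m n; rewrite -!mulmxE -!map_mxM [LHS]mxE [RHS]mxE !mulmxE.
  apply/eqP; rewrite -subr_eq0 -rmorphB; apply/eqP/piE.
  have := congr1 (fun X : 'M_2 => X m n) (tl_centralizer k (CH i) (CH j)).
  by rewrite [LHS]mxE [RHS]mxE /I mulrBl ![_ * tl H k]mulrC => ->; rewrite subrr.
have := central_order (seifert_rep_morph pi rep) piC.
rewrite /=; case: euler_order => [|N]; first by rewrite /= !mul0r.
(* In the quotient H^N = 1 has traceless part 0, and the traceless part of H^N is U_N(tr H) times
   that of H. *)
rewrite SL2_exp ?det_map_mx ?dH ?rmorph1 // trace_map_mx -chebU_morph => HN.
have := congr1 (fun X => tl X l) HN; rewrite tl_scale.
have -> : tl (1 : 'M[B']_2) l = 0.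
  by case: (ord3P l) => ->; rewrite /tl /= !mxE //= subrr.
have -> : tl (map_mx pi H) l = pi (tl H l).
  by case: (ord3P l) => ->; rewrite /tl /= !mxE // rmorphB.
by rewrite -rmorphM => /piE; rewrite /I => <-; rewrite mulrAC.
Qed.

(** The discriminant (tr H)^2 - 4 is a quadratic form in the coordinates of the traceless part of H,
    and U_N(tr H) kills each of its monomials. *)
Lemma chebW_tr_H : chebW (\tr H) euler_order = 0.
Proof.
have [[_ dH] _ _ _] := rep.
have -> : chebW (\tr H) euler_order = chebU (\tr H) euler_order * (\tr H ^+ 2 - 4 * \det H).
  by rewrite dH mulr1.
rewrite disc2E mulrDr expr2 !mulrA [_ * 4]mulrC -!mulrA.
by rewrite !(mulrA (chebU _ _)) !chebU_annihilates mulr0 addr0.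
Qed.

End Representations.

(** * Rank one idempotents and simultaneous diagonalization *)

Section Idempotents.
Variable S : comNzRingType.
Implicit Types e X Y : 'M[S]_2.

(** This is Cayley-Hamilton for [e * X] with one factor [X] cancelled against its adjugate. *)
Lemma sandwich2E e X : e * X * e = \tr (e * X) *: e - \det e *: \adj X.
Proof.
rewrite adj2E; apply: matrix2P; split;
  by rewrite !(mul2E, mxE) ?tr2E ?det2E !mul2E /= ?mulr1n ?mulr0n; ring.
Qed.

(** Cayley-Hamilton turns these two equations into [e * e = e]: [e] is a projector onto a line. *)
Definition rank1_idempotent e : Prop := \tr e = 1 /\ \det e = 0.

Lemma rank1_idempotentP e : rank1_idempotent e -> e * e = e.
Proof. by move=> [te de]; rewrite cayley2 te de scale1r raddf0 subr0. Qed.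

Lemma rank1_idempotent_compl e : rank1_idempotent e -> rank1_idempotent (1 - e).
Proof.
move=> [te de]; have := de; have := te; rewrite !entry2E /rank1_idempotent !entry2E !mxE /=.
move=> t d; split; first by rewrite addrACA -opprD t; ring.
transitivity (1 - (e 0 0 + e 1 1) + (e 0 0 * e 1 1 - e 0 1 * e 1 0)).
  by rewrite ?mulr0n ?mulr1n; ring.
by rewrite t d subrr addr0.
Qed.

(** Commutation gives [X * e = e * X * e], and the sandwich formula applies. Thus [\tr (e * X)] is
    the eigenvalue of [X] on the line cut out by [e]. *)
Lemma rank1_eigen e X : rank1_idempotent e -> X * e = e * X -> X * e = \tr (e * X) *: e.
Proof.
move=> re Xe; have ee := rank1_idempotentP re; case: re => te de.
have := sandwich2E e X; rewrite de scale0r subr0 => <-.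
by rewrite -mulrA Xe mulrA ee.
Qed.

Lemma rank1_eigenM e X Y : rank1_idempotent e -> X * e = e * X -> Y * e = e * Y ->
  \tr (e * (X * Y)) = \tr (e * X) * \tr (e * Y).
Proof.
move=> re Xe Ye; have -> : e * (X * Y) = X * (Y * e) by rewrite Ye mulrA -Xe -mulrA.
rewrite (rank1_eigen re Ye) -scalerAr (rank1_eigen re Xe) !mxtraceZ (proj1 re).
by rewrite mulr1 mulrC.
Qed.

Lemma rank1_eigenX e X n : rank1_idempotent e -> X * e = e * X ->
  \tr (e * X ^+ n) = \tr (e * X) ^+ n.
Proof.
move=> re Xe; elim: n => [|n IH]; first by rewrite !expr0 mulr1 (proj1 re).
rewrite !exprS rank1_eigenM ?IH //.
by elim: n {IH} => [|n IH]; rewrite ?expr0 ?mulr1 ?mul1r // exprS -mulrA IH !mulrA Xe.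
Qed.

End Idempotents.

Lemma sum_inverse_exists (F : numClosedFieldType) (r : F) : exists2 x, x != 0 & x + x^-1 = r.
Proof.
have [x xP] := @solve_monicpoly F 2 (fun k => [:: -1; r]`_k) isT.
move: xP; rewrite big_ord_recl big_ord1 /= expr0 expr1 mulr1 => xP.
have x0 : x != 0.
  apply/eqP => x0; move/eqP: xP; rewrite x0 expr0n mulr0 addr0 eq_sym oppr_eq0.
  by rewrite oner_eq0.
by exists x => //; apply: (mulfI x0); rewrite mulrDr divff // -expr2 xP; ring.
Qed.

Section Torus.
Variables (F : numClosedFieldType) (B : comNzRingType) (i : {rmorphism F -> B}).
Hypothesis connB : connected B.
Variables (p a b : 'I_3 -> nat) (C : 'I_3 -> 'M[B]_2) (H : 'M[B]_2).
Hypothesis rep : seifert_rep p a b C H.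
Hypotheses (p_gt0 : forall j, (0 < p j)%N) (order_gt0 : (0 < euler_order p a b)%N).

Lemma eigen_const e : rank1_idempotent e -> H * e = e * H ->
  (forall j, C j * e = e * C j) -> (forall j k, C j * C k = C k * C j) ->
  (exists l, \tr (e * H) = i l) /\ (forall j, exists l, \tr (e * C j) = i l).
Proof.
move=> re He Ce CC; have [_ CH CpH _] := rep.
have powe X n : X * e = e * X -> X ^+ n * e = e * X ^+ n.
  by move=> Xe; elim: n => [|n IH]; rewrite ?expr0 ?mulr1 ?mul1r // exprS -mulrA IH !mulrA Xe.
have HN : \tr (e * H) ^+ euler_order p a b = i 1.
  rewrite rmorph1 -rank1_eigenX // (central_order rep CC) mulr1; exact: (proj1 re).
have [l lN Hl] := power_root connB order_gt0 (oner_neq0 F) HN.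
have l0 : l != 0.
  by apply: contra_eq_neq lN => ->; rewrite expr0n eqn0Ngt order_gt0 eq_sym oner_neq0.
split=> [|j]; first by exists l.
have Cj : \tr (e * C j) ^+ p j = i (l ^+ b j / l ^+ a j).
  have := congr1 (fun X => \tr (e * X)) (CpH j).
  rewrite /= rank1_eigenM ?rank1_eigenX ?powe // Hl => Cj.
  rewrite rmorphM !rmorphXn -Cj -mulrA -!rmorphXn -rmorphM divff ?expf_neq0 //.
  by rewrite rmorph1 mulr1.
have [|m _ Cm] := power_root connB (p_gt0 j) _ Cj; last by exists m.
by rewrite mulf_neq0 ?invr_neq0 ?expf_neq0.
Qed.

(** The eigenvalues x and 1/x differ by a constant unit, so the spectral projector exists over [B].
    Its formula shows that whatever commutes with [Y] commutes with [e]. *)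
Lemma eigen_idempotent Y (r x : F) : \det Y = 1 -> \tr Y = i r -> r ^+ 2 != 4 ->
  x != 0 -> x + x^-1 = r ->
  exists e, [/\ rank1_idempotent e, Y = i x *: e + i x^-1 *: (1 - e)
    & e = i (x - x^-1)^-1 *: (Y - (i x^-1)%:M)].
Proof.
move=> dY tY r4 x0 xr.
have xV : x - x^-1 != 0.
  apply: contra r4 => /eqP xV; rewrite -subr_eq0 -xr.
  have -> : (x + x^-1) ^+ 2 - 4 = (x - x^-1) ^+ 2 by field.
  by rewrite xV expr0n.
pose d := (x - x^-1)^-1.
pose e := i d *: (Y - (i x^-1)%:M).
have ix : i x * i x^-1 = 1 by rewrite -rmorphM divff // rmorph1.
have idx : i d * (i x - i x^-1) = 1 by rewrite -rmorphB -rmorphM mulVf // rmorph1.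
have re : rank1_idempotent e.
  have ty : Y 0 0 + Y 1 1 = i x + i x^-1 by rewrite -tr2E tY -xr rmorphD.
  move: dY; rewrite det2E => dY.
  split; rewrite !entry2E !mxE /= ?mulr0n ?mulr1n -?idx.
    by transitivity (i d * (Y 0 0 + Y 1 1 - 2 * i x^-1)); [ring | rewrite ty; ring].
  transitivity (i d ^+ 2 * ((Y 0 0 * Y 1 1 - Y 0 1 * Y 1 0)
    - i x^-1 * (Y 0 0 + Y 1 1) + i x^-1 ^+ 2)); first ring.
  by rewrite dY ty -ix; ring.
exists e; split=> //.
have -> : i x *: e + i x^-1 *: (1 - e) = (i x - i x^-1) *: e + (i x^-1)%:M.
  by rewrite scalerBr scalerBl scalemx1 addrCA addrC.
by rewrite /e scalerA mulrC idx scale1r subrK.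
Qed.

(** [Y] will be [H] or some [C j]; its two spectral projectors split all the matrices at once. *)
Lemma torus_form Y (r : F) : \det Y = 1 -> \tr Y = i r -> r ^+ 2 != 4 ->
  Y * H = H * Y -> (forall j, Y * C j = C j * Y) ->
  (forall j k, C j * C k = C k * C j) ->
  exists2 e, rank1_idempotent e &
    (exists l m, H = i l *: e + i m *: (1 - e)) /\
    (forall j, exists l m, C j = i l *: e + i m *: (1 - e)).
Proof.
move=> dY tY r4 YH YC CC.
have [x x0 xr] := sum_inverse_exists r.
have [e [re _ eE]] := eigen_idempotent dY tY r4 x0 xr.
have comm_e X : Y * X = X * Y -> X * e = e * X.
  move=> YX; rewrite eE -scalerAl -scalerAr mulrBl mulrBr YX.
  by rewrite -!mulmxE scalar_mxC.
have comm_e' X : Y * X = X * Y -> X * (1 - e) = (1 - e) * X.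
  by move=> YX; rewrite mulrBl mulrBr comm_e // mul1r mulr1.
have re' := rank1_idempotent_compl re.
have [[lH HlH] lC] := eigen_const re (comm_e _ YH) (fun j => comm_e _ (YC j)) CC.
have [[mH HmH] mC] := eigen_const re' (comm_e' _ YH) (fun j => comm_e' _ (YC j)) CC.
have decomp X l m : Y * X = X * Y -> \tr (e * X) = i l -> \tr ((1 - e) * X) = i m ->
    X = i l *: e + i m *: (1 - e).
  move=> YX <- <-; rewrite -!rank1_eigen ?comm_e ?comm_e' //.
  by rewrite -mulrDl addrC subrK mul1r.
exists e => //; split; first by exists lH, mH; apply: decomp.
move=> j; have [l Hl] := lC j; have [m Hm] := mC j.
by exists l, m; apply: decomp.
Qed.

End Torus.

(** * Units up to nilpotents, and the Fricke polynomial *)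

Section Units.
Variable S : comNzRingType.
Implicit Types u d x y : S.

Definition invertible u : Prop := exists v, v * u = 1.

Lemma invertible_perturb u d : invertible u -> d ^+ 2 = 0 -> invertible (u + d).
Proof.
move=> [v vu] d2; exists (v ^+ 2 * (u - d)).
transitivity ((v * u) ^+ 2 - v ^+ 2 * d ^+ 2); first ring.
by rewrite vu d2 expr1n mulr0 subr0.
Qed.

Lemma invertible_perturb_diff x y q : invertible x -> forall d, d ^+ 2 = 0 ->
  y - x = d * q -> invertible y.
Proof.
move=> ux d d2 yx; have -> : y = x + d * q by rewrite -yx addrC subrK.
by apply: invertible_perturb => //; rewrite exprMn d2 mul0r.
Qed.

Lemma invertible_mul_eq0 u x : invertible u -> u * x = 0 -> x = 0.
Proof. by move=> [v vu] ux; rewrite -[x]mul1r -vu -mulrA ux mulr0. Qed.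

Lemma chebU_diff x y n : exists q, chebU x n - chebU y n = (x - y) * q.
Proof.
suff: (exists q, chebU x n - chebU y n = (x - y) * q) /\
   exists q, chebU x n.+1 - chebU y n.+1 = (x - y) * q by case.
elim: n => [|n [[q1 IH1] [q2 IH2]]].
  by split; exists 0; rewrite mulr0 /= subrr.
split; first by exists q2.
exists (chebU x n.+1 + y * q2 - q1); rewrite !chebUSS.
transitivity ((x - y) * chebU x n.+1 + y * (chebU x n.+1 - chebU y n.+1)
  - (chebU x n - chebU y n)); first ring.
by rewrite IH1 IH2; ring.
Qed.

Lemma chebT_diff x y n : exists q, chebT x n - chebT y n = (x - y) * q.
Proof.
have [q1 E1] := chebU_diff x y n; have [q2 E2] := chebU_diff x y n.+1.
exists (q2 *+ 2 - chebU x n - y * q1); rewrite /chebT.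
transitivity ((chebU x n.+1 - chebU y n.+1) *+ 2 - (x - y) * chebU x n
  - y * (chebU x n - chebU y n)); first ring.
by rewrite E1 E2; ring.
Qed.

(** For A, B in SL_2 with traces x, y and tr(AB) = z, this is the trace of the group commutator
    minus 2; over a closed field it vanishes exactly on reducible pairs. *)
Definition fricke x y z := x ^+ 2 + y ^+ 2 + z ^+ 2 - x * y * z - 4.

Lemma det_commutator (A B : 'M[S]_2) : \det A = 1 -> \det B = 1 ->
  \det (A * B - B * A) = - fricke (\tr A) (\tr B) (\tr (A * B)).
Proof.
rewrite !det2E => dA dB; rewrite /fricke.
(* Inserting the determinants gives an identity between polynomials in the entries, valid without
   constraints. *)
transitivity (- ((\tr A) ^+ 2 * (B 0 0 * B 1 1 - B 0 1 * B 1 0)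
   + (\tr B) ^+ 2 * (A 0 0 * A 1 1 - A 0 1 * A 1 0) + \tr (A * B) ^+ 2
   - \tr A * \tr B * \tr (A * B)
   - 4 * (A 0 0 * A 1 1 - A 0 1 * A 1 0) * (B 0 0 * B 1 1 - B 0 1 * B 1 0))).
  rewrite !mxE !tr2E !sum2E !mul2E; clear.
  move: (A 0 0) (A 0 1) (A 1 0) (A 1 1) (B 0 0) (B 0 1) (B 1 0) (B 1 1) => *; ring.
by rewrite dA dB !mulr1.
Qed.

Lemma tr_SL2_exp (A : 'M[S]_2) n : (0 < n)%N -> \det A = 1 ->
  \tr (A ^+ n) = chebT (\tr A) n.
Proof.
case: n => // n _ dA; rewrite SL2_exp // /chebT chebUSS.
move: (chebU _ n.+1) (chebU _ n) => u v.
by rewrite raddfB /= mxtraceZ mxtrace_scalar; ring.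
Qed.

Lemma nilpotent_sum_exp (X : 'M[S]_2) n : X * X = 0 -> (1 + X) ^+ n = 1 + n%:R *: X.
Proof.
move=> XX; elim: n => [|n IH]; first by rewrite expr0 scale0r addr0.
rewrite exprS IH mulrDl mul1r mulrDr mulr1 -scalerAr XX scaler0 addr0.
by rewrite -addrA -natr1 scalerDl scale1r.
Qed.

End Units.

Section Field.
Variable F : numClosedFieldType.

Lemma chebT_sum_inverse (x : F) n : x != 0 -> chebT (x + x^-1) n = x ^+ n + x ^- n.
Proof.
move=> x0.
have E m : (x - x^-1) * chebU (x + x^-1) m = x ^+ m - x ^- m.
  suff: (x - x^-1) * chebU (x + x^-1) m = x ^+ m - x ^- m /\
     (x - x^-1) * chebU (x + x^-1) m.+1 = x ^+ m.+1 - x ^- m.+1 by case.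
  elim: m => [|m [IH1 IH2]]; first by rewrite /= mulr0 mulr1 expr0 invr1 subrr expr1.
  split=> //; rewrite chebUSS mulrBr mulrCA IH1 IH2 -!exprVn !exprS.
  have : x * x^-1 = 1 by rewrite divff.
  move: (x^-1) => y xy.
  by transitivity (x * (x * x ^+ m) - y * (y * y ^+ m) + (x * y - 1) * (x ^+ m - y ^+ m));
    [ring | rewrite xy subrr mul0r addr0].
suff: forall m, chebT (x + x^-1) m = x ^+ m + x ^- m /\
   chebT (x + x^-1) m.+1 = x ^+ m.+1 + x ^- m.+1 by move=> /(_ n) [].
have TSS (z : F) m : chebT z m.+2 = z * chebT z m.+1 - chebT z m.
  by rewrite /chebT !chebUSS; ring.
elim=> [|m [IH1 IH2]].
  by rewrite /chebT /= expr0 invr1 expr1; split; ring.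
split=> //; rewrite TSS IH1 IH2 -!exprVn !exprS.
have : x * x^-1 = 1 by rewrite divff.
move: (x^-1) => y xy.
by transitivity (x * (x * x ^+ m) + y * (y * y ^+ m) + (x * y - 1) * (x ^+ m + y ^+ m));
    [ring | rewrite xy subrr mul0r addr0].
Qed.

Variables p a b : 'I_3 -> nat.

(** These are the first eigenvalues [eps] of h and [x j] of c_j in a diagonal representation;
    [x j ^+ 2 != 1] says that the image of c_j is not I or -I. *)
Definition exceptional_numbers : Prop :=
  exists (eps : F) (x : 'I_3 -> F),
    [/\ eps ^+ 2 = 1, x 0 * x 1 * x 2 = 1, forall j, x j ^+ p j * eps ^+ a j = eps ^+ b j
      & forall j, x j ^+ 2 != 1].

Lemma fricke_exceptional (eps : F) (r : 'I_3 -> F) :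
  eps ^+ 2 = 1 -> (forall j, r j ^+ 2 != 4) ->
  (forall j, chebT (r j) (p j) = eps ^+ (a j + b j) *+ 2) ->
  fricke (r 0) (r 1) (r 2) = 0 -> exceptional_numbers.
Proof.
move=> eps2 r4 Tr fr.
have [x x0 xr] := sum_inverse_exists (r 0); have [y y0 yr] := sum_inverse_exists (r 1).
(* As a polynomial in [r 2], the Fricke polynomial has roots xy + 1/(xy) and x/y + y/x; replacing y
   by its inverse reduces the second case to the first. *)
have [z z0 [zr xyz]] : exists2 z, z != 0 & z + z^-1 = r 1 /\ x * z + (x * z)^-1 = r 2.
  have : (r 2 - (x * y + (x * y)^-1)) * (r 2 - (x * y^-1 + (x * y^-1)^-1)) = 0.
    by rewrite -fr /fricke -xr -yr; field; rewrite x0 y0.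
  move/eqP; rewrite mulf_eq0 !subr_eq0 => /orP[] /eqP ->; first by exists y.
  by exists y^-1; rewrite ?invr_eq0 // invrK addrC.
pose w (j : 'I_3) := [:: x; z; (x * z)^-1]`_j.
have w0 j : w j != 0.
  by case: (ord3P j) => ->; rewrite /w //= invr_eq0 mulf_neq0.
have wr j : w j + (w j)^-1 = r j.
  by case: (ord3P j) => ->; rewrite /w //= invrK addrC.
exists eps, w; split=> // [|j|j].
- by rewrite /w /= divff // mulf_neq0.
- have := Tr j; rewrite -wr chebT_sum_inverse // => Ej.
  have epsX2 n : eps ^+ n * eps ^+ n = 1 by rewrite -expr2 exprAC eps2 expr1n.
  (* The equation w^p + w^-p = 2 eps^(a+b) has w^p = eps^(a+b) as a double root, because eps^2 =
     1. *)
  have : (w j ^+ p j - eps ^+ (a j + b j)) ^+ 2 = 0.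
    transitivity (w j ^+ p j * (w j ^+ p j + w j ^- p j - eps ^+ (a j + b j) *+ 2)).
      rewrite mulrBr mulrDr divff ?expf_neq0 // -(epsX2 (a j + b j)%N); ring.
    by rewrite Ej subrr mulr0.
  move/eqP; rewrite sqrf_eq0 subr_eq0 => /eqP ->.
  by rewrite exprD mulrAC epsX2 mul1r.
- apply: contra (r4 j) => /eqP w2; rewrite -wr.
  have -> : (w j)^-1 = w j by apply: (mulfI (w0 j)); rewrite divff // -expr2 w2.
  by rewrite -mulr2n exprMn_n w2.
Qed.

End Field.

(** * Torus type or irreducible type *)

Section Dichotomy.
Variables (F : numClosedFieldType) (B : comNzRingType) (i : {rmorphism F -> B}).
Hypothesis connB : connected B.
Variables (p a b : 'I_3 -> nat) (C : 'I_3 -> 'M[B]_2) (H : 'M[B]_2).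
Hypothesis rep : seifert_rep p a b C H.
Hypotheses (p_gt0 : forall j, (0 < p j)%N) (order_gt0 : (0 < euler_order p a b)%N).

Definition torus_type : Prop :=
  exists2 e : 'M[B]_2, rank1_idempotent e &
    (exists l m, H = i l *: e + i m *: (1 - e)) /\
    (forall j, exists l m, C j = i l *: e + i m *: (1 - e)).

Definition irreducible_type : Prop :=
  exists (h : F) (r : 'I_3 -> F),
    [/\ H = (i h)%:M, forall j, \tr (C j) = i (r j), r 0 ^+ 2 != 4
      & fricke (r 0) (r 1) (r 2) != 0].

Lemma invertible_const (x : F) : x != 0 -> invertible (i x).
Proof. by move=> x0; exists (i x^-1); rewrite -rmorphM mulVf // rmorph1. Qed.

(** Every [tl H l] kills the commutators of the [C j], hence so does (tr H)^2 - 4, which is a unit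
    here. *)
Lemma commuting_of_regular (t : F) : \tr H = i t -> t ^+ 2 != 4 ->
  forall j k, C j * C k = C k * C j.
Proof.
move=> tH t4 j k; have [[_ dH] CH _ _] := rep.
have cent l := tl_centralizer l (CH j) (CH k).
apply/matrixP => m n; apply/eqP; rewrite -subr_eq0; apply/eqP.
set z := _ - _; have tz l : tl H l * z = 0.
  have := congr1 (fun X : 'M_2 => X m n) (cent l).
  by rewrite [LHS]mxE [RHS]mxE /z mulrBr => ->; rewrite subrr.
apply: (@invertible_mul_eq0 _ (i (t ^+ 2 - 4))).
  by apply: invertible_const; rewrite subr_eq0.
have -> : i (t ^+ 2 - 4) = \tr H ^+ 2 - 4 * \det H.
  by rewrite tH dH mulr1 rmorphB rmorphXn rmorph_nat.
by rewrite disc2E expr2 mulrDl -!mulrA !tz !mulr0 addr0.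
Qed.

(** By [C 0 * C 1 * C 2 = 1], a product of two neighbours is the inverse of the third matrix, so
    centrality of one matrix makes the other two commute. *)
Lemma all_commute_of_one j : (forall k, C j * C k = C k * C j) ->
  forall k l, C k * C l = C l * C k.
Proof.
move=> cj; have [[dC _] _ _ C012] := rep.
have inv (X Y : 'M[B]_2) : \det X = 1 -> X * Y = 1 -> Y = \adj X.
  by move=> dX XY; apply: (SL2_mulI dX); rewrite XY (proj1 (adj2_unit dX)).
have E0 : C 1 * C 2 = \adj (C 0) by apply: inv; rewrite ?dC // mulrA.
have E2 : C 0 * C 1 = \adj (C 2).
  have [_ a2] := adj2_unit (dC 2).
  by rewrite -[C 0 * C 1]mulr1 -(proj1 (adj2_unit (dC 2))) mulrA C012 mul1r.
have comm_adj (X Y : 'M[B]_2) : X * Y = Y * X -> \adj X * Y = Y * \adj X.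
  by move=> XY; rewrite adj2E mulrBl mulrBr XY -!mulmxE scalar_mxC.
have main : C 0 * C 1 = C 1 * C 0 /\ C 0 * C 2 = C 2 * C 0 /\ C 1 * C 2 = C 2 * C 1.
  case: (ord3P j) cj => -> cj.
  - split; first exact: cj.
    split; first exact: cj.
    by apply: (SL2_mulI (dC 1)); rewrite E0 (mulrA (C 1)) E0 comm_adj.
  - split; first by rewrite cj.
    split; last exact: cj.
    apply: (SL2_mulI (dC 1)); rewrite 2!mulrA cj E2 E0.
    by rewrite !(proj2 (adj2_unit _)).
  - split; last by rewrite !cj.
    by apply: (SL2_mulI (dC 0)); rewrite E2 (mulrA (C 0)) E2 comm_adj.
case: main => c01 [c02 c12] k l.
by case: (ord3P k) => ->; case: (ord3P l) => ->.
Qed.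

Lemma scalar_of_tl0 (X : 'M[B]_2) (x : F) : (forall k, tl X k = 0) -> \tr X = i x ->
  X = (i (x / 2))%:M.
Proof.
move=> /tl_eq0 X0; rewrite {1}X0 mxtrace_scalar => X2; rewrite X0; congr (_%:M).
 rewrite rmorphM -X2 mulrnAl -mulrnAr -rmorphMn -mulr_natr mulVf ?pnatr_eq0 //.
by rewrite rmorph1 mulr1.
Qed.

(** As [C j ^+ p j] is scalar, U_p(tr C_j) kills the traceless part of C_j, hence also the
    discriminant, so the trace is a root of W_p. If r is 2 or -2, U_p(r) is a unit and the traceless
    part itself vanishes. *)
Lemma scalar_fibre (eps : F) : eps ^+ 2 = 1 -> H = (i eps)%:M -> forall j,
  exists r, \tr (C j) = i r /\ (r ^+ 2 = 4 -> C j = (i (r / 2))%:M).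
Proof.
move=> eps2 HE j; have [[dC _] _ CpH _] := rep.
have HX n : H ^+ n = (i eps ^+ n)%:M.
  by elim: n => [|n IH]; rewrite ?expr0 // !exprS IH HE -mulmxE -scalar_mxM.
have Cp : C j ^+ p j = (i eps ^+ (a j + b j))%:M.
  have epsX : i eps ^+ a j * i eps ^+ a j = 1.
    by rewrite -expr2 exprAC -rmorphXn eps2 rmorph1 expr1n.
  have := congr1 (fun X => X * H ^+ a j) (CpH j).
  rewrite /= -mulrA !HX -!mulmxE -!scalar_mxM epsX mulmx1 => ->.
  by rewrite exprD mulrC.
have utl k : chebU (\tr (C j)) (p j) * tl (C j) k = 0.
  have := congr1 (fun X => tl X k) Cp; case: (p j) (p_gt0 j) => // n _.
  rewrite /= SL2_exp // tl_scale => ->.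
  by case: (ord3P k) => ->; rewrite /tl /= !mxE //= subrr.
have W0 : chebW (\tr (C j)) (p j) = 0.
  have := disc2E (C j); rewrite /chebW dC mulr1 => ->.
  transitivity (chebU (\tr (C j)) (p j) * tl (C j) 2 * tl (C j) 2
    + chebU (\tr (C j)) (p j) * tl (C j) 0 * (4 * tl (C j) 1)); first ring.
  by rewrite !utl !mul0r addr0.
have [r _ tr] := chebW_root i connB (p_gt0 j) W0.
exists r; split=> // r4; apply: scalar_of_tl0 => // k.
apply: (invertible_mul_eq0 _ (utl k)); rewrite tr -chebU_morph.
exact/invertible_const/chebU_ramified_neq0.
Qed.

Lemma torus_of_commuting_scalar (eps : F) : eps ^+ 2 = 1 -> H = (i eps)%:M ->
  (forall j k, C j * C k = C k * C j) -> torus_type.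
Proof.
move=> eps2 HE CC; have [[dC dH] CH _ _] := rep.
have [[j [r [tr r4]]]|all4] := boolp.pselect (exists j r, \tr (C j) = i r /\ r ^+ 2 != 4).
  apply: (torus_form connB rep p_gt0 order_gt0 (dC j) tr r4 (CH j) (CC j) CC).
(* Here all the matrices are scalar, so any rank one idempotent will do. *)
pose e : 'M[B]_2 := delta_mx 0 0.
have scal x : (i x)%:M = i x *: e + i x *: (1 - e) by rewrite -scalerDr addrC subrK scalemx1.
exists e.
  by split; rewrite !entry2E !mxE /= ?addr0 ?mulr0 ?mul0r ?subrr.
split; first by exists eps, eps; rewrite HE scal.
move=> j; have [r [tr r4]] := scalar_fibre eps2 HE j.
exists (r / 2), (r / 2); rewrite -scal; apply: r4.
by apply: boolp.contrapT => /eqP r4; apply: all4; exists j, r.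
Qed.

Lemma dichotomy : ~ exceptional_numbers F p a b -> torus_type \/ irreducible_type.
Proof.
move=> noexc; have [[dC dH] CH CpH C012] := rep.
have [t Wt tH] := chebW_root i connB order_gt0 (chebW_tr_H rep).
have [/eqP t4|t4] := boolP (t ^+ 2 == 4); last first.
  have CC := commuting_of_regular tH t4.
  by left; apply: (torus_form connB rep p_gt0 order_gt0 dH tH t4 _ _ CC) => // j; rewrite CH.
have two0 : 2 != 0 :> F by rewrite pnatr_eq0.
pose eps := t / 2; have teps : t = eps *+ 2 by rewrite /eps -mulr_natr divfK.
have eps2 : eps ^+ 2 = 1 by rewrite /eps exprMn t4 exprVn -natrX divff // pnatr_eq0.
have H_scalar : (forall k, tl H k = 0) -> H = (i eps)%:M.
  by move=> tl0; apply: scalar_of_tl0.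
have torus : (forall j k, C j * C k = C k * C j) -> torus_type.
  move=> CC; apply: (torus_of_commuting_scalar eps2) => //; apply: H_scalar => k.
  have := congr1 (fun X => tl X k) (central_order rep CC).
  have ut := chebU_ramified_neq0 order_gt0 t4.
  case: (euler_order p a b) order_gt0 ut => // n _ ut.
  rewrite /= SL2_exp // tl_scale tH -chebU_morph => utl.
  apply: (invertible_mul_eq0 (invertible_const ut)); rewrite utl.
  by case: (ord3P k) => ->; rewrite /tl /= !mxE //= subrr.
(* From here on tr H = 2 eps, and H is eps times the unipotent 1 + n with n of square zero; its
   powers are linear in the exponent. *)
pose n := i eps *: H - 1.
have ieps2 : i eps * i eps = 1 by rewrite -rmorphM -expr2 eps2 rmorph1.
have HE : H = i eps *: (1 + n) by rewrite /n addrC subrK scalerA ieps2 scale1r.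
have nn : n * n = 0.
  have HH : H * H = (i eps *+ 2) *: H - 1 by rewrite cayley2 dH tH teps rmorphMn.
  rewrite /n mulrBl mul1r mulrBr mulr1 -scalerAl -scalerAr scalerA ieps2 scale1r HH.
  by apply/matrixP => k l; rewrite !mxE; ring.
have HX k : H ^+ k = i eps ^+ k *: (1 + k%:R *: n).
  rewrite -nilpotent_sum_exp // HE.
  elim: k => [|k IH]; first by rewrite !expr0 scale1r.
  by rewrite exprS IH -scalerAl -scalerAr scalerA -!exprS.
have epsX k : i eps ^+ k * i eps ^+ k = 1 by rewrite -exprMn ieps2 expr1n.
have tr_n : \tr n = 0.
  by rewrite /n raddfB /= mxtraceZ mxtrace1 tH teps rmorphMn mulrnAr ieps2 subrr.
have Cp j : C j ^+ p j = i eps ^+ (a j + b j) *: (1 + ((b j)%:R - (a j)%:R) *: n).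
  have inv : (1 + (a j)%:R *: n) * (1 - (a j)%:R *: n) = 1.
    rewrite mulrBr mulr1 mulrDl mul1r -scalerAl -scalerAr nn !scaler0 addr0.
    by rewrite addrK.
  have := congr1 (fun X => X * (i eps ^+ a j *: (1 - (a j)%:R *: n))) (CpH j).
  rewrite /= -mulrA !HX -!scalerAl -!scalerAr inv !scalerA epsX scale1r mulr1 => ->.
  rewrite exprD [X in X *: _]mulrC; congr (_ *: _).
  rewrite mulrBr mulr1 mulrDl mul1r -scalerAl -scalerAr nn !scaler0 addr0.
  by rewrite scalerBl -addrA.
have Ts j : chebT (\tr (C j)) (p j) = i (eps ^+ (a j + b j) *+ 2).
  rewrite -tr_SL2_exp // Cp mxtraceZ raddfD /= mxtraceZ tr_n mulr0 addr0 mxtrace1.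
  by rewrite mulr_natr rmorphMn rmorphXn.
have utl j k : chebU (\tr (C j)) (p j) * tl (C j) k
    = i eps ^+ (a j + b j) * ((b j)%:R - (a j)%:R) * i eps * tl H k.
  have := congr1 (fun X => tl X k) (Cp j).
  case: (p j) (p_gt0 j) => // m _; rewrite SL2_exp // tl_scale => ->.
  by case: (ord3P k) => ->; rewrite /tl /= !mxE //=; ring.
(* W_p^2 = (x^2 - 4) (T_p^2 - 4) vanishes at x = tr C_j, since T_p takes the value 2 or -2 there.
   Only the square is known to vanish, so the trace is constant up to an element of square zero. *)
have rP j : exists r, [/\ chebW r (p j) = 0, (\tr (C j) - i r) ^+ 2 = 0
    & chebT r (p j) = eps ^+ (a j + b j) *+ 2].
  have W2 : chebW (\tr (C j)) (p j) ^+ 2 = 0.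
    transitivity ((\tr (C j) ^+ 2 - 4) * (chebT (\tr (C j)) (p j) ^+ 2 - 4)).
      by rewrite chebT_pell /chebW; ring.
    have -> : chebT (\tr (C j)) (p j) ^+ 2 - 4 = 0; last by rewrite mulr0.
    rewrite Ts -rmorphXn exprMn_n exprAC eps2 expr1n -(rmorph_nat i 4) -rmorphB.
    by rewrite subrr rmorph0.
  have [r Wr sr] := chebW_root_nilpotent i connB (p_gt0 j) W2.
  exists r; split=> //; apply/eqP; rewrite -subr_eq0; apply/eqP.
  apply: (@nilpotent_const F B i _ 2).
  rewrite rmorphB chebT_morph -Ts -opprB sqrrN.
  have [c ->] := chebT_diff (\tr (C j)) (i r) (p j).
  by rewrite exprMn sr mul0r.
have [r rE] := boolp.choice rP.
have [[j rj4]|all4] := boolp.pselect (exists j, r j ^+ 2 = 4).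
  left; apply: torus; apply: (@all_commute_of_one j) => k.
  have [_ sj _] := rE j.
  (* U_p(tr C_j) differs from the unit U_p(r_j) by an element of square zero. Being a unit, it makes
     the traceless part of C_j a multiple of that of H, with which all C_k commute. *)
  have [w wu] : invertible (chebU (\tr (C j)) (p j)).
    have [c uc] := chebU_diff (\tr (C j)) (i (r j)) (p j).
    apply: (invertible_perturb_diff _ sj uc); rewrite -chebU_morph.
    exact/invertible_const/chebU_ramified_neq0.
  have [c tlC] : exists c, forall l, tl (C j) l = c * tl H l.
    by eexists => l; rewrite -[LHS]mul1r -wu -mulrA utl mulrA; reflexivity.
  rewrite -[LHS]scale1r -[RHS]scale1r; apply: comm_tl => l m; rewrite !tlC.
  transitivity (c * (tl (C k) m * tl H l - tl (C k) l * tl H m)); first ring.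
  by rewrite (tl_comm (CH k)) subrr mulr0.
have r4 j : r j ^+ 2 != 4 by apply/eqP => rj; apply: all4; exists j.
have fr0 : fricke (r 0) (r 1) (r 2) != 0.
  apply/eqP => fr0; apply: noexc.
  by apply: (fricke_exceptional eps2 r4 _ fr0) => j; have [] := rE j.
have trC2 : \tr (C 2) = \tr (C 0 * C 1).
  have -> : C 0 * C 1 = \adj (C 2).
    by rewrite -[LHS]mulr1 -(proj1 (adj2_unit (dC 2))) mulrA C012 mul1r.
  by rewrite adj2E raddfB /= mxtrace_scalar mulr2n addrK.
(* The constants r_j are exchanged for the traces one at a time, each exchange changing the value by
   a multiple of a square-zero element. *)
have fr_unit : invertible (fricke (\tr (C 0)) (\tr (C 1)) (\tr (C 2))).
  have s j : (\tr (C j) - i (r j)) ^+ 2 = 0 by have [] := rE j.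
  have u0 : invertible (fricke (i (r 0)) (i (r 1)) (i (r 2))).
    have -> : fricke (i (r 0)) (i (r 1)) (i (r 2)) = i (fricke (r 0) (r 1) (r 2)).
      by rewrite /fricke rmorphB rmorph_nat rmorphB !rmorphD !rmorphXn !rmorphM.
    exact: invertible_const.
  have u1 : invertible (fricke (\tr (C 0)) (i (r 1)) (i (r 2))).
    apply: (invertible_perturb_diff (q := \tr (C 0) + i (r 0) - i (r 1) * i (r 2)) u0 (s 0)).
    by rewrite /fricke; ring.
  have u2 : invertible (fricke (\tr (C 0)) (\tr (C 1)) (i (r 2))).
    apply: (invertible_perturb_diff (q := \tr (C 1) + i (r 1) - \tr (C 0) * i (r 2)) u1 (s 1)).
    by rewrite /fricke; ring.
  apply: (invertible_perturb_diff (q := \tr (C 2) + i (r 2) - \tr (C 0) * \tr (C 1)) u2 (s 2)).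
  by rewrite /fricke; ring.
(* [tl H k] kills the entries of C_0 C_1 - C_1 C_0, hence its determinant, which is minus the Fricke
   unit. *)
have HE' : H = (i eps)%:M.
  apply: H_scalar => k; apply: (invertible_mul_eq0 fr_unit).
  have := det_commutator (dC 0) (dC 1); rewrite -trC2 => /(congr1 -%R).
  rewrite opprK => <-.
  set X := _ - _; have X0 m l : tl H k * X m l = 0.
    have := congr1 (fun X : 'M_2 => X m l) (tl_centralizer k (CH 0) (CH 1)).
    by rewrite [LHS]mxE [RHS]mxE => E;
      rewrite /X [X in _ * X]mxE [X in _ + X]mxE mulrBr E subrr.
  rewrite det2E mulrC mulrN mulrBr !mulrA !X0 !mul0r subrr oppr0.
  by [].
(* With H scalar the traces are exactly constant; these constants agree with [r] because a nilpotent
   constant is zero. *)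
right; have [r' r'E] := boolp.choice (scalar_fibre eps2 HE').
have rr' j : r' j = r j.
  have [_ sj _] := rE j; apply/eqP; rewrite -subr_eq0; apply/eqP.
  by apply: (@nilpotent_const F B i _ 2); rewrite rmorphB -(proj1 (r'E j)).
exists eps, r; split=> // j; by rewrite -rr'; case: (r'E j).
Qed.
End Dichotomy.

(** * Invariant functions are constant *)

Section Vanishing.
Variables (F : numFieldType) (B : comNzRingType) (i : {rmorphism F -> B}).

(** Linear factors can be split off one by one although [B] may have zero divisors, because
    differences of distinct constants are units. *)
Lemma poly_vanish_seq (s : seq F) (Q : {poly B}) : uniq s -> (size Q <= size s)%N ->
  (forall y, y \in s -> Q.[i y] = 0) -> Q = 0.
Proof.
elim: s Q => [|y s IH] Q; first by move=> _; rewrite leqn0 size_poly_eq0 => /eqP.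
move=> /andP[ys us] sQ Qs.
have [q Qq] : exists q, Q = q * ('X - (i y)%:P).
  by apply/factor_theorem; rewrite /root Qs // mem_head.
have q0 : q = 0.
  apply: IH => // [|z zs].
    have [->|qn0] := eqVneq q 0; first by rewrite size_poly0.
    by move: sQ; rewrite Qq size_Mmonic ?monicXsubC // size_XsubC addn2.
  have := Qs z; rewrite in_cons zs orbT Qq hornerM hornerXsubC => /(_ isT).
  move=> qz; have zy : z - y != 0.
    by rewrite subr_eq0; apply: contraNneq ys => <-.
  rewrite -[LHS]mulr1 -(rmorph1 i) -(divff zy) rmorphM mulrA rmorphB qz.
  by rewrite mul0r.
by rewrite Qq q0 mul0r.
Qed.

Lemma poly_vanish (Q : {poly B}) : (forall y, Q.[i y] = 0) -> Q = 0.
Proof.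
move=> Qs; apply: (@poly_vanish_seq [seq k%:R | k <- iota 0 (size Q)]) => //.
  by rewrite map_inj_uniq ?iota_uniq // => m n /eqP; rewrite eqr_nat => /eqP.
by rewrite size_map size_iota.
Qed.

End Vanishing.

Section Homogenization.
Variables (F : fieldType) (n : nat) (f : {mpoly F[n]}).

(** This is d^D f(v/d) with D = [msize f], written without division; D exceeds every degree in the
    support, so the truncated subtraction is exact. *)
Definition homog_eval (S : comNzRingType) (psi : F -> S) (d : S) (v : 'I_n -> S) : S :=
  \sum_(m <- msupp f) psi f@_m * d ^+ (msize f - mdeg m) * \prod_k v k ^+ m k.

Lemma homog_eval_scale (S : comNzRingType) (psi : F -> S) (d : S) (v : 'I_n -> S) :
  homog_eval psi d (fun k => d * v k) = d ^+ msize f * mmap psi v f.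
Proof.
rewrite /homog_eval /mmap mulr_sumr; apply: eq_big_seq => m mf.
have -> : \prod_k (d * v k) ^+ m k = d ^+ mdeg m * mmap1 v m.
  rewrite mdegE -prodrXr -big_split /=; apply: eq_bigr => k _; exact: exprMn.
have lt : (mdeg m < msize f)%N by apply: msize_mdeg_lt.
rewrite -[in RHS](subnK (ltnW lt)) exprD.
by rewrite mulrA -(mulrA _ (d ^+ _) (d ^+ mdeg m)) -mulrA mulrCA.
Qed.

Lemma homog_eval_morph (S S' : comNzRingType) (h : {rmorphism S -> S'})
    (psi : F -> S) (d : S) (v : 'I_n -> S) :
  h (homog_eval psi d v) = homog_eval (h \o psi) (h d) (h \o v).
Proof.
rewrite rmorph_sum; apply: eq_bigr => m _; rewrite !rmorphM rmorphXn rmorph_prod.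
by congr (_ * _); apply: eq_bigr => k _; rewrite rmorphXn.
Qed.

Lemma homog_eval_ext (S : comNzRingType) (psi psi' : F -> S) (d d' : S) (v v' : 'I_n -> S) :
  psi =1 psi' -> d = d' -> v =1 v' -> homog_eval psi d v = homog_eval psi' d' v'.
Proof.
move=> Epsi -> Ev; apply: eq_bigr => m _; rewrite Epsi; congr (_ * _).
by apply: eq_bigr => k _; rewrite Ev.
Qed.

Lemma mmap_morph (S S' : comNzRingType) (h : {rmorphism S -> S'})
    (psi : F -> S) (v : 'I_n -> S) : h (mmap psi v f) = mmap (h \o psi) (h \o v) f.
Proof.
rewrite /mmap rmorph_sum; apply: eq_bigr => m _; rewrite rmorphM rmorph_prod.
by congr (_ * _); apply: eq_bigr => k _; rewrite rmorphXn.
Qed.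

Lemma mmap_ext (S : comNzRingType) (psi psi' : F -> S) (v v' : 'I_n -> S) :
  psi =1 psi' -> v =1 v' -> mmap psi v f = mmap psi' v' f.
Proof.
move=> Epsi Ev; apply: eq_bigr => m _; rewrite Epsi; congr (_ * _).
by apply: eq_bigr => k _; rewrite Ev.
Qed.

End Homogenization.

Section Conjugation.
Variables (F : numClosedFieldType) (f : {mpoly F[16]}).

Definition row_of (k : 'I_16) : 'I_2 := inord ((k %% 4) %/ 2).
Definition col_of (k : 'I_16) : 'I_2 := inord (k %% 2).

Lemma vidxK (k : 'I_16) : vidx (k %/ 4) (row_of k) (col_of k) = k.
Proof.
by case: k => k; do 16?[case: k => [|k]] => // lt; apply: val_inj;
  rewrite /vidx /row_of /col_of /= !inordK.
Qed.

Lemma vidx_split (j : nat) (c d : 'I_2) : (j < 4)%N ->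
  [/\ (vidx j c d %/ 4)%N = j, row_of (vidx j c d) = c & col_of (vidx j c d) = d].
Proof.
by move=> j4; case: (ord2P c) => ->; case: (ord2P d) => ->;
  case: j j4 => [|[|[|[|]]]] // _; rewrite /row_of /col_of /vidx /= !inordK //=;
  split=> //; apply: val_inj; rewrite /= inordK.
Qed.

Definition coord_mx (S : Type) (X : 'I_16 -> S) (j : nat) : 'M[S]_2 :=
  \matrix_(c, d) X (vidx j c d).

(** The adjugate replaces the inverse: for invertible [g] this is [\det g] times the conjugate, and
    it makes sense for every [g]. *)
Definition conj_coord (S : comNzRingType) (g : 'M[S]_2) (X : 'I_16 -> S) (k : 'I_16) : S :=
  (g * coord_mx X (k %/ 4) * \adj g) (row_of k) (col_of k).

(* Clearing the denominators of f (g X g^-1) - f X. *)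
Definition defect (S : comNzRingType) (psi : F -> S) (X : 'I_16 -> S) (g : 'M[S]_2) : S :=
  \det g * (homog_eval f psi (\det g) (conj_coord g X) - \det g ^+ msize f * mmap psi X f).

Lemma defect_morph (S S' : comNzRingType) (h : {rmorphism S -> S'}) psi X g :
  h (defect psi X g) = defect (h \o psi) (h \o X) (map_mx h g).
Proof.
rewrite /defect rmorphM rmorphB rmorphM rmorphXn mmap_morph homog_eval_morph det_map_mx.
congr (_ * (_ - _)); apply: homog_eval_ext => // k.
rewrite /conj_coord -map_mx_adj /= -!mulmxE.
have -> : coord_mx (h \o X) (k %/ 4) = map_mx h (coord_mx X (k %/ 4)).
  by apply/matrixP => c d; rewrite !mxE.
by rewrite -!map_mxM [RHS]mxE.
Qed.

Lemma defect_ext (S : comNzRingType) (psi psi' : F -> S) X X' g :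
  psi =1 psi' -> X =1 X' -> defect psi X g = defect psi' X' g.
Proof.
move=> Epsi EX; rewrite /defect (mmap_ext _ Epsi EX).
congr (_ * (_ - _)); apply: homog_eval_ext => // k.
rewrite /conj_coord.
suff -> : coord_mx X (k %/ 4) = coord_mx X' (k %/ 4) by [].
by apply/matrixP => c d; rewrite !mxE EX.
Qed.

Variables (B : comNzRingType) (i : {rmorphism F -> B}) (X : 'I_16 -> B).

Lemma defect_extend (g : 'M[B]_2) (m l : 'I_2) :
  (forall y : F, defect i X (g + i y *: delta_mx m l) = 0) ->
  forall x : B, defect i X (g + x *: delta_mx m l) = 0.
Proof.
move=> vanish x.
(* The varying entry becomes the indeterminate, giving a polynomial over [B] that vanishes at all
   constants. *)
pose Q := defect (polyC \o i) (polyC \o X) (map_mx polyC g + 'X *: delta_mx m l).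
have QE z : Q.[z] = defect i X (g + z *: delta_mx m l).
  rewrite -/(horner_eval z Q) defect_morph.
  rewrite (@defect_ext _ _ i _ X) => [||k]; [|by move=> y /=; rewrite horner_evalE hornerC
    | by rewrite /= horner_evalE hornerC].
  congr defect; apply/matrixP => c d; rewrite !mxE /= rmorphD rmorphM rmorph_nat /=.
  by rewrite !horner_evalE hornerC hornerX.
rewrite -QE (_ : Q = 0) ?horner0 //.
by apply: (poly_vanish (i := i)) => y; rewrite QE.
Qed.

Lemma mx2_delta (S : comNzRingType) (g : 'M[S]_2) :
  g = g 0 0 *: delta_mx 0 0 + g 0 1 *: delta_mx 0 1 + g 1 0 *: delta_mx 1 0
    + g 1 1 *: delta_mx 1 1.
Proof. by apply: matrix2P; rewrite !mxE /=; split; ring. Qed.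

(** The four entries of [g] are released one at a time from constants in [F] to arbitrary elements
    of [B]. *)
Lemma defect_eq0 : (forall g : 'M[F]_2, defect i X (map_mx i g) = 0) ->
  forall g : 'M[B]_2, defect i X g = 0.
Proof.
move=> vanish g; rewrite [g]mx2_delta.
apply: defect_extend => t; rewrite addrAC.
apply: defect_extend => z; rewrite -addrA addrAC.
apply: defect_extend => y; rewrite -addrA addrC.
apply: defect_extend => x.
rewrite (_ : _ + _ = map_mx i (\matrix_(c, d)
  if c == 0 then (if d == 0 then x else y) else if d == 0 then z else t)) ?vanish //.
by apply: matrix2P; rewrite !mxE /=; split; ring.
Qed.

Hypothesis X_constant_on_orbits : forall g : 'M[F]_2, \det g = 1 ->
  mmap i (conj_coord (map_mx i g) X) f = mmap i X f.

(** A square root of the determinant rescales [g] into SL_2, where invariance applies. If the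
    determinant is 0, the leading factor [\det g] of [defect] settles the claim. *)
Lemma defect_const (g : 'M[F]_2) : defect i X (map_mx i g) = 0.
Proof.
rewrite /defect; have [d0|d0] := eqVneq (\det g) 0.
  by rewrite det_map_mx d0 rmorph0 mul0r.
pose s := sqrtC (\det g); have ss : s ^+ 2 = \det g by rewrite sqrtCK.
have s0 : s != 0 by rewrite sqrtC_eq0.
have dg1 : \det (s^-1 *: g) = 1 by rewrite detZ -ss exprVn mulVf // expf_neq0.
have gE : g = s *: (s^-1 *: g) by rewrite scalerA divff // scale1r.
have E := X_constant_on_orbits dg1.
have -> : homog_eval f i (\det (map_mx i g)) (conj_coord (map_mx i g) X)
   = homog_eval f i (\det (map_mx i g))
      (fun k => \det (map_mx i g) * conj_coord (map_mx i (s^-1 *: g)) X k).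
  apply: homog_eval_ext => // k.
  rewrite {1}gE /conj_coord map_mxZ !adj2E mxtraceZ -[(_ * \tr _)%:M]scale_scalar_mx -scalerBr.
  rewrite -!scalerAl -scalerAr scalerA [LHS]mxE det_map_mx -ss -rmorphM -expr2.
  by congr (_ * _).
by rewrite homog_eval_scale E subrr mulr0.
Qed.

(* The intertwiner g need not be invertible, so its determinant remains as a
   factor. *)
Lemma constant_of_intertwiner (g : 'M[B]_2) (A : 'I_16 -> F) :
  (forall j, (j < 4)%N -> coord_mx X j * g = g * map_mx i (coord_mx A j)) ->
  \det g ^+ (msize f).+1 * (mmap i X f - i f.@[A]) = 0.
Proof.
move=> Xg.
have adjK : \adj (\adj g) = g.
  by rewrite !adj2E raddfB /= mxtrace_scalar mulr2n addrK opprB addrC subrK.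
have d_adj : \det (\adj g) = \det g.
  by rewrite adj2E !det2E !mxE tr2E /= ?mulr1n ?mulr0n; ring.
(* Conjugating by [\adj g] turns [X] into [\adj g * X * g], which is [\det g] times the constant
   matrices [A]. *)
have := defect_eq0 defect_const (\adj g).
rewrite /defect d_adj.
have -> : homog_eval f i (\det g) (conj_coord (\adj g) X)
   = homog_eval f i (\det g) (fun k => \det g * i (A k)).
  apply: homog_eval_ext => // k; rewrite /conj_coord adjK -mulrA Xg; last first.
    by case: k => k /= lt; rewrite ltn_divLR.
  rewrite -!mulmxE mulmxA mul_adj_mx mul_scalar_mx !mxE.
  by rewrite vidxK.
rewrite homog_eval_scale -mulrBr mulrA -exprS => E.
rewrite -[RHS]oppr0 -E -mulrN opprB; congr (_ * (_ - _)).
by rewrite /meval (mmap_morph f i).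
Qed.

End Conjugation.

Section NilpotentOn.
Variables (S : comNzRingType).
Implicit Types d y : S.

(** Such [d] form the radical of the annihilator of [y]. Several intertwiners, none of them
    invertible, can thus be combined through their determinants. *)
Definition nilpotent_on y d : Prop := exists k, d ^+ k * y = 0.

Lemma nilpotent_onD y d d' : nilpotent_on y d -> nilpotent_on y d' -> nilpotent_on y (d + d').
Proof.
move=> [k dk] [l dl]; have [n] := ubnP (k + l); elim: n k l y dk dl => // n IH.
case=> [|k] [|l] y dk dl;
  try by move: dk dl; rewrite expr0 mul1r => *; exists 0%N; rewrite expr0 mul1r.
rewrite addSn addnS !ltnS => kl.
(* Induction on k + l, applied to [d * y] and [d' * y], each of which lowers one exponent. *)
have [|||m1 E1] := IH k l.+1 (d * y); last 1 first.
- have [|||m2 E2] := IH k.+1 l (d' * y); last 1 first.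
  + exists (m1 + m2).+1.
    transitivity ((d + d') ^+ m2 * ((d + d') ^+ m1 * (d * y))
      + (d + d') ^+ m1 * ((d + d') ^+ m2 * (d' * y))).
      by rewrite exprS exprD; ring.
    by rewrite E1 E2 !mulr0 addr0.
  + by rewrite mulrCA dk mulr0.
  + by rewrite mulrA -exprSr.
  + by rewrite addSn.
- by rewrite mulrA -exprSr.
- by rewrite mulrCA dl mulr0.
- by rewrite addnS.
Qed.

Lemma nilpotent_onMl y c d : nilpotent_on y d -> nilpotent_on y (c * d).
Proof. by move=> [k dk]; exists k; rewrite exprMn -mulrA dk mulr0. Qed.

Lemma nilpotent_on_unit y d : nilpotent_on y d -> invertible d -> y = 0.
Proof.
move=> [k dk] [v vd]; rewrite -[y]mul1r -(expr1n _ k) -vd exprMn -mulrA dk.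
by rewrite mulr0.
Qed.

End NilpotentOn.

Section Constancy.
Variables (F : numClosedFieldType) (f : {mpoly F[16]}).
Variables (B : comNzRingType) (i : {rmorphism F -> B}) (X : 'I_16 -> B).
Hypothesis X_constant_on_orbits : forall g : 'M[F]_2, \det g = 1 ->
  mmap i (conj_coord (map_mx i g) X) f = mmap i X f.

Notation C := (fun j : 'I_3 => coord_mx X j).
Notation H := (coord_mx X 3).

Definition coord_of (S : Type) (A : nat -> 'M[S]_2) (k : 'I_16) : S :=
  A (k %/ 4)%N (row_of k) (col_of k).

Lemma coord_mxK (S : Type) (A : nat -> 'M[S]_2) j : (j < 4)%N -> coord_mx (coord_of A) j = A j.
Proof.
move=> j4; apply/matrixP => c d; rewrite mxE /coord_of.
by have [-> -> ->] := vidx_split c d j4.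
Qed.

Lemma nilpotent_on_intertwiner (A : nat -> 'M[F]_2) (g : 'M[B]_2) :
  (forall j, (j < 4)%N -> coord_mx X j * g = g * map_mx i (A j)) ->
  nilpotent_on (mmap i X f - i f.@[coord_of A]) (\det g).
Proof.
move=> Xg; exists (msize f).+1.
by apply: constant_of_intertwiner => // j j4; rewrite coord_mxK // Xg.
Qed.

Lemma coord_index_cases (T : nat -> Prop) : (forall j : 'I_3, T j) -> T 3 ->
  forall j, (j < 4)%N -> T j.
Proof.
move=> T3 T4 j; rewrite ltnS leq_eqVlt => /orP[/eqP -> //|j3].
exact: (T3 (Ordinal j3)).
Qed.

(** With [E] the projector onto the first axis, [e * T * E + (1 - e) * T * (1 - E)] is an
    intertwiner with a constant diagonal representation, for every [T]. *)
Lemma torus_constant : torus_type i C H -> exists c, mmap i X f = i c.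
Proof.
move=> [e re [H_lm C_lm]].
have /boolp.choice[l] : forall j : nat, exists l : F * F, (j < 4)%N ->
    coord_mx X j = i l.1 *: e + i l.2 *: (1 - e).
  move=> j; have [j4|j4] := boolP (j < 4)%N; last by exists (0, 0).
  suff [l [m lm]] : exists l m, coord_mx X j = i l *: e + i m *: (1 - e) by exists (l, m).
  by move: j j4; apply: coord_index_cases => // j; have [l [m]] := C_lm j; exists l, m.
move=> lE; pose E : 'M[B]_2 := delta_mx 0 0.
pose A j : 'M[F]_2 := (l j).1 *: delta_mx 0 0 + (l j).2 *: (1 - delta_mx 0 0).
exists f.@[coord_of A]; apply/eqP; rewrite -subr_eq0; apply/eqP.
have ee := rank1_idempotentP re.
have EE : E * E = E by rewrite -mulmxE mul_delta_mx.
have det_nil T : nilpotent_on (mmap i X f - i f.@[coord_of A])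
    (\det (e * T * E + (1 - e) * T * (1 - E))).
  apply: nilpotent_on_intertwiner => j j4; rewrite lE //.
  have -> : map_mx i (A j) = i (l j).1 *: E + i (l j).2 *: (1 - E).
    by rewrite /A map_mxD !map_mxZ map_mxB map_mx1 map_delta_mx.
  set g := e * T * E + _.
  have e0 : e * (1 - e) = 0 by rewrite mulrBr mulr1 ee subrr.
  have E0 : (1 - E) * E = 0 by rewrite mulrBl mul1r EE subrr.
  have eg : e * g = e * T * E by rewrite /g mulrDr !mulrA ee e0 !mul0r addr0.
  have gE : g * E = e * T * E by rewrite /g mulrDl -!mulrA EE E0 !mulr0 addr0.
  by clearbody g; rewrite mulrDl mulrDr -!scalerAl -!scalerAr mulrBl mulrBr mul1r mulr1 eg gE.
(* For [T = 1] and [T] the swap the determinants are [e 0 0 - \det e] and [\det e - e 1 1]; their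
   difference is 1. *)
have := nilpotent_onD (det_nil 1)
  (nilpotent_onMl (-1) (det_nil (delta_mx 0 1 + delta_mx 1 0))).
move/nilpotent_on_unit; apply; exists 1; rewrite mul1r.
transitivity (\tr e - 2 * \det e); last by case: re => -> ->; rewrite mulr0 subr0.
by rewrite tr2E !det2E !(mul2E, mxE) /= ?mulr0n ?mulr1n; ring.
Qed.

(* The columns of the intertwiner are an eigenvector v of C 0 for x and its image
   under C 1 - alpha, which is an eigenvector for x^-1. *)
Lemma irreducible_constant :
  (forall j : 'I_3, \det (coord_mx X j) = 1) ->
  coord_mx X 0 * coord_mx X 1 * coord_mx X 2 = 1 ->
  irreducible_type i C H -> exists c, mmap i X f = i c.
Proof.
move=> dC C012 [h [r [HE tr r4 fr]]].
pose C0 := coord_mx X 0; pose C1 := coord_mx X 1; pose C2 := coord_mx X 2.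
have [d0 d1 d2] : [/\ \det C0 = 1, \det C1 = 1 & \det C2 = 1].
  by split; [exact: (dC 0) | exact: (dC 1) | exact: (dC 2)].
have [t0 t1 t2] : [/\ \tr C0 = i (r 0), \tr C1 = i (r 1) & \tr C2 = i (r 2)].
  by split; [exact: (tr 0) | exact: (tr 1) | exact: (tr 2)].
have C2E : C2 = \adj (C0 * C1).
  by apply: (@SL2_mulI _ (C0 * C1)); rewrite ?det_mulmx ?d0 ?d1 ?mulr1 // C012
    (proj1 (adj2_unit _)) // -mulmxE det_mulmx d0 d1 mulr1.
have t01 : \tr (C0 * C1) = i (r 2).
  by rewrite -t2 C2E adj2E raddfB /= mxtrace_scalar mulr2n addrK.
have [x x0 xr] := sum_inverse_exists (r 0).
have [e [re C0E eE]] := eigen_idempotent d0 t0 r4 x0 xr.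
have ee := rank1_idempotentP re.
have [alpha al] : exists alpha, \tr (e * C1) = i alpha.
  exists ((x - x^-1)^-1 * (r 2 - x^-1 * r 1)).
  rewrite eE -scalerAl mxtraceZ mulrBl raddfB /= t01 -mulmxE mul_scalar_mx mxtraceZ t1.
  by rewrite rmorphM rmorphB rmorphM.
(* [beta] gives [A1] determinant 1 and [gamma] gives it trace [r 1]; [alpha] is the corner entry of
   [C1] in an eigenbasis of [C0]. *)
pose gamma := r 1 - alpha; pose beta := alpha * gamma - 1.
pose E : 'M[F]_2 := delta_mx 0 0.
pose A0 : 'M[F]_2 := x *: E + x^-1 *: (1 - E).
pose A1 : 'M[F]_2 := \matrix_(c, d)
  (if c == 0 then (if d == 0 then alpha else beta) else if d == 0 then 1 else gamma).
pose A := nth 0 [:: A0; A1; \adj (A0 * A1); h%:M].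
exists f.@[coord_of A]; apply/eqP; rewrite -subr_eq0; apply/eqP.
set y := _ - _.
(* The first column of [V u0 u1] is the eigenvector e (u0, u1); the second is zero. *)
pose V (u0 u1 : B) : 'M[B]_2 := e * (u0 *: delta_mx 0 0 + u1 *: delta_mx 1 0).
pose g u0 u1 : 'M[B]_2 := V u0 u1 + (C1 - (i alpha)%:M) * V u0 u1 * delta_mx 0 1.
have nil u0 u1 : nilpotent_on y (\det (g u0 u1)).
  apply: nilpotent_on_intertwiner; pose v := V u0 u1; pose D c d : 'M[B]_2 := delta_mx c d.
  have ev : e * v = v by rewrite /v /V mulrA ee.
  have vE : v * D 0 0 = v.
    rewrite /v /V -mulrA; congr (_ * _).
    by apply: matrix2P; rewrite !(mul2E, mxE) /=; split; ring.
  have gE : g u0 u1 = v + (C1 - (i alpha)%:M) * v * D 0 1 by [].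
  clearbody v; move: (g u0 u1) gE => G gE.
  have mapE : map_mx i E = D 0 0 by rewrite map_delta_mx.
  (* The sandwich formula gives e C1 e = alpha e, so (C1 - alpha) v lies in the kernel of e, the
     eigenspace for 1/x. *)
  have eC1v : e * (C1 - (i alpha)%:M) * v = 0.
    have -> : (i alpha)%:M = i alpha *: (1 : 'M[B]_2) by rewrite scalemx1.
    rewrite mulrBr mulrBl -scalerAr mulr1 -scalerAl ev.
    by rewrite -{1}ev mulrA sandwich2E (proj2 re) scale0r subr0 al -scalerAl ev subrr.
  have D0100 : D 0 1 * D 0 0 = 0 by rewrite -mulmxE mul_delta_mx_0.
  have eg : e * G = v by rewrite gE mulrDr ev !mulrA eC1v mul0r addr0.
  have gD : G * D 0 0 = v by rewrite gE mulrDl vE -!mulrA D0100 !mulr0 addr0.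
  have inter0 : C0 * G = G * map_mx i A0.
    have -> : map_mx i A0 = i x *: D 0 0 + i x^-1 *: (1 - D 0 0).
      by rewrite /A0 map_mxD !map_mxZ map_mxB map_mx1 mapE.
    rewrite C0E mulrDl mulrDr -!scalerAl -!scalerAr mulrBl mulrBr mul1r mulr1.
    by rewrite eg gD.
  have inter1 : C1 * G = G * map_mx i A1.
    have A1v : D 0 0 * map_mx i A1 = i alpha *: D 0 0 + i beta *: D 0 1.
      by apply: matrix2P; rewrite !(mul2E, mxE) /=; split; ring.
    have A1w : D 0 1 * map_mx i A1 = D 0 0 + i gamma *: D 0 1.
      by apply: matrix2P; rewrite !(mul2E, mxE) /= rmorph1; split; ring.
    move: gE; set w := (C1 - _) * v => gE.
    have C1v : C1 * v = i alpha *: v + w.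
      by rewrite /w mulrBl -[(i alpha)%:M]scalemx1 -scalerAl mul1r addrC subrK.
    have wE : w * D 0 0 = w by rewrite /w -mulrA vE.
    have C1w : C1 * w = i beta *: v + i gamma *: w.
      transitivity (C1 * C1 * v - i alpha *: (C1 * v)).
        by rewrite /w mulrBl mulrBr -[(i alpha)%:M]scalemx1 -scalerAl mul1r -scalerAr mulrA.
      rewrite cayley2 d1 t1 mulrBl -scalerAl mul1r addrAC -scalerBl -rmorphB -/gamma C1v.
      rewrite scalerDr scalerA addrAC -[X in _ - X]scale1r -scalerBl -(rmorph1 i).
      by rewrite -rmorphM -rmorphB mulrC.
    have vA : v * map_mx i A1 = i alpha *: v + i beta *: (v * D 0 1).
      by rewrite -{1}vE -mulrA A1v mulrDr -!scalerAr vE.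
    have wA : w * D 0 1 * map_mx i A1 = w + i gamma *: (w * D 0 1).
      by rewrite -mulrA A1w mulrDr wE -scalerAr.
    clearbody w; rewrite gE mulrDr mulrDl vA wA mulrA C1v C1w mulrDl -!scalerAl.
    by rewrite addrACA.
  have dA : \det (A0 * A1) = 1.
    rewrite -mulmxE det_mulmx !det2E !mxE /= ?mulr0n ?mulr1n /beta.
    by field.
  apply: coord_index_cases => [j|]; last first.
    by rewrite HE map_scalar_mx -!mulmxE scalar_mxC.
  case: (ord3P j) => -> //.
  rewrite -[coord_mx X _]/C2 -[A _]/(\adj (A0 * A1)) map_mx_adj.
  have mapA : map_mx i (A0 * A1) = map_mx i A0 * map_mx i A1 by rewrite -!mulmxE map_mxM.
  have dCC : \det (C0 * C1) = 1 by rewrite -mulmxE det_mulmx d0 d1 mulr1.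
  apply: (SL2_mulI dCC); rewrite C2E mulrA (proj1 (adj2_unit dCC)) mul1r.
  have -> : C0 * C1 * (G * \adj (map_mx i (A0 * A1))) =
      G * (map_mx i (A0 * A1) * \adj (map_mx i (A0 * A1))).
    by rewrite mulrA -(mulrA C0) inter1 (mulrA C0) inter0 mapA !mulrA.
  by rewrite (proj1 (adj2_unit _)) ?mulr1 // det_map_mx dA rmorph1.
have r2E : r 2 = x * alpha + x^-1 * gamma.
  apply: (@fmorph_inj _ _ i); rewrite -t01 C0E mulrDl -!scalerAl mulrBl mul1r.
  rewrite mxtraceD !mxtraceZ raddfB /= al t1.
  by rewrite rmorphD !rmorphM rmorphB.
(* If [beta] were 0, [A0] and [A1] would both be lower triangular, which is where the Fricke
   polynomial vanishes. *)
have beta0 : beta != 0.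
  apply: contra fr => /eqP b0; apply/eqP.
  transitivity (- (x - x^-1) ^+ 2 * beta); last by rewrite b0 mulr0.
  rewrite /fricke r2E -xr; have -> : r 1 = alpha + gamma by rewrite /gamma addrC subrK.
  by rewrite /beta; field.
have betaE : i beta = \tr C1 * \tr (e * C1) - \det C1 - \tr (e * C1) ^+ 2.
  by rewrite t1 d1 al /beta /gamma rmorphB rmorphM rmorphB rmorph1; ring.
(* [\det (g u0 u1)] is a quadratic form in (u0, u1). Its values at (1,0), (0,1) and (1,1), weighted
   by suitable entries of [C1], add up to the unit 2 beta. *)
pose b : B := C1 1 1 - C1 0 0.
have := nilpotent_onD (nilpotent_onMl (C1 0 1 *+ 2 - b) (nil 1 0))
  (nilpotent_onD (nilpotent_onMl (- C1 1 0 *+ 2 - b) (nil 0 1)) (nilpotent_onMl b (nil 1 1))).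
move/nilpotent_on_unit; apply.
suff -> : (C1 0 1 *+ 2 - b) * \det (g 1 0)
    + ((- C1 1 0 *+ 2 - b) * \det (g 0 1) + b * \det (g 1 1)) = i (beta *+ 2).
  by apply: invertible_const; rewrite mulrn_eq0.
rewrite rmorphMn /= betaE.
transitivity ((\tr e * \tr C1 * \tr (e * C1) - \tr e ^+ 2 * \det C1 - \tr (e * C1) ^+ 2) *+ 2
  - (b ^+ 2 + 4 * C1 0 1 * C1 1 0) * \det e); last first.
  by case: re => -> ->; rewrite expr1n !mul1r mulr0 subr0.
rewrite /b /g /V !det2E !tr2E !(mul2E, mxE) /= ?mulr0n ?mulr1n; ring.
Qed.

End Constancy.

(** * The universal representation *)

Section Ideal.
Variables (F : fieldType) (gs : seq {mpoly F[16]}).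

Lemma in_idealP x : in_ideal gs x <->
  exists c : nat -> {mpoly F[16]}, x = \sum_(i < size gs) c i * gs`_i.
Proof.
split=> [[cs ->]|[c ->]]; first by exists (nth 0 cs).
exists (mkseq c (size gs)); apply: eq_bigr => j _.
by rewrite nth_mkseq.
Qed.

Lemma in_ideal_is_ideal : is_ideal (in_ideal gs).
Proof.
split=> [|x y /in_idealP[c ->] /in_idealP[d ->]|z x /in_idealP[c ->]]; apply/in_idealP.
- by exists (fun _ => 0); rewrite big1 // => j _; rewrite mul0r.
- exists (fun k => c k + d k); rewrite -big_split; apply: eq_bigr => j _.
  by rewrite mulrDl.
- by exists (fun k => z * c k); rewrite mulr_sumr; apply: eq_bigr => j _; rewrite mulrA.
Qed.

Lemma in_ideal_gen x : x \in gs -> in_ideal gs x.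
Proof.
move=> xgs; apply/in_idealP; exists (fun k => (k == index x gs)%:R).
have lt : (index x gs < size gs)%N by rewrite index_mem.
rewrite (bigD1 (Ordinal lt)) //= eqxx mul1r nth_index // big1 ?addr0 // => j ne.
by rewrite (negPf (ne : (j : nat) != index x gs)) mul0r.
Qed.

End Ideal.

Lemma mem_mx_entries (T : eqType) (A : 'M[T]_2) c d : A c d \in mx_entries A.
Proof. by apply/allpairsP; exists (c, d); rewrite !mem_enum. Qed.

Section Generators.
Variables (F : fieldType) (p : 'I_3 -> nat) (q : 'I_3 -> int).

Lemma rel_gens_det j : (j < 4)%N -> \det (Xv F j) - 1 \in rel_gens F p q.
Proof.
move=> j4; rewrite mem_cat; apply/orP; left; apply/mapP; exists j => //.
by rewrite mem_iota.
Qed.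

Lemma rel_gens_comm (j : 'I_3) c d :
  (Xv F j *m Xv F 3 - Xv F 3 *m Xv F j) c d \in rel_gens F p q.
Proof.
rewrite !mem_cat; apply/orP; right; apply/orP; left; apply/flatten_mapP.
by exists j; rewrite ?mem_enum ?mem_mx_entries.
Qed.

Lemma rel_gens_fibre (j : 'I_3) c d :
  (Xv F j ^+ p j *m zpow (Xv F 3) (q j) - 1%:M) c d \in rel_gens F p q.
Proof.
rewrite !mem_cat; apply/orP; right; apply/orP; right; apply/orP; left.
by apply/flatten_mapP; exists j; rewrite ?mem_enum ?mem_mx_entries.
Qed.

Lemma rel_gens_base c d :
  (Xv F 0 *m Xv F 1 *m Xv F 2 - 1%:M) c d \in rel_gens F p q.
Proof. by rewrite !mem_cat mem_mx_entries !orbT. Qed.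

End Generators.

Definition pos_part (z : int) : nat := if z is Posz n then n else 0.
Definition neg_part (z : int) : nat := if z is Negz n then n.+1 else 0.

Lemma zpow_mul (S : comNzRingType) (X Y : 'M[S]_2) z : \det Y = 1 ->
  X *m zpow Y z = 1%:M -> X * Y ^+ pos_part z = Y ^+ neg_part z.
Proof.
move=> dY; case: z => n; rewrite /= mulmxE => XY; first by rewrite XY.
have cancel k : (\adj Y) ^+ k * Y ^+ k = 1.
  elim: k => [|k IH]; first by rewrite !expr0 mulr1.
  by rewrite exprSr exprS mulrA -(mulrA _ (\adj Y)) (proj2 (adj2_unit dY)) mulr1.
by rewrite expr0 mulr1 -[RHS]mul1r -[1 in RHS]XY -mulrA cancel mulr1.
Qed.

Lemma zpow_morph (S S' : comNzRingType) (h : {rmorphism S -> S'}) (Y : 'M[S]_2) z :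
  map_mx h (zpow Y z) = zpow (map_mx h Y) z.
Proof.
by case: z => n; rewrite /= -?map_mx_adj exp_map_mx2.
Qed.

Section Universal.
Variables (F : numClosedFieldType) (p : 'I_3 -> nat) (q : 'I_3 -> int).
Notation P := {mpoly F[16]}.
Notation I := (in_ideal (rel_gens F p q)).
Variables (B : comNzRingType) (phi : {rmorphism P -> B}).
Hypothesis phiI : forall x, I x -> phi x = 0.

Definition const_morph : {rmorphism F -> B} := phi \o @mpolyC 16 F.
Definition coords (k : 'I_16) : B := phi 'X_k.

Lemma coord_mx_coords j : coord_mx coords j = map_mx phi (Xv F j).
Proof. by apply/matrixP => c d; rewrite !mxE. Qed.

Lemma phi_mmap f : phi f = mmap const_morph coords f.
Proof.
rewrite {1}[f]mpolyE rmorph_sum; apply: eq_bigr => m _.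
rewrite -mul_mpolyC rmorphM mpolyXE_id rmorph_prod; congr (_ * _).
by apply: eq_bigr => k _; rewrite rmorphXn.
Qed.

Lemma phi_mx_eq (X Y : 'M[P]_2) : (forall c d, I ((X - Y) c d)) ->
  map_mx phi X = map_mx phi Y.
Proof.
move=> XY; apply/matrixP => c d; rewrite !mxE; apply/eqP.
by rewrite -subr_eq0 -rmorphB; apply/eqP/phiI; have := XY c d; rewrite !mxE.
Qed.

Lemma universal_rep : seifert_rep p (pos_part \o q) (neg_part \o q)
  (fun j : 'I_3 => coord_mx coords j) (coord_mx coords 3).
Proof.
have dX j : (j < 4)%N -> \det (coord_mx coords j) = 1.
  move=> j4; rewrite coord_mx_coords det_map_mx; apply/eqP.
  rewrite -subr_eq0 -(rmorph1 phi) -rmorphB; apply/eqP/phiI/in_ideal_gen.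
  exact: rel_gens_det.
split.
- by split=> [j|]; apply: dX => //; apply: leq_trans (ltn_ord j) _.
- move=> j; rewrite !coord_mx_coords -!mulmxE -!map_mxM; apply: phi_mx_eq => c d.
  exact/in_ideal_gen/rel_gens_comm.
- move=> j; apply: zpow_mul; first exact: dX.
  rewrite !coord_mx_coords exp_map_mx2 -zpow_morph -map_mxM -(map_mx1 phi).
  by apply: phi_mx_eq => c d; apply/in_ideal_gen/rel_gens_fibre.
- rewrite !coord_mx_coords -!mulmxE -!map_mxM -[RHS](map_mx1 phi).
  by apply: phi_mx_eq => c d; apply/in_ideal_gen/rel_gens_base.
Qed.

Lemma invariant_on_orbits f : invariant_class (rel_gens F p q) f ->
  forall g : 'M[F]_2, \det g = 1 ->
  mmap const_morph (conj_coord (map_mx const_morph g) coords) f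
    = mmap const_morph coords f.
Proof.
move=> invf g dg; rewrite -phi_mmap; have /phiI/eqP := invf g dg.
rewrite rmorphB subr_eq0 => /eqP <-; rewrite /comp_mpoly mmap_morph.
apply: mmap_ext => // k; rewrite /= tnth_mktuple /conj_mx /conj_coord.
have -> : invmx g = \adj g by rewrite /invmx unitmxE dg unitr1 invr1 scale1r.
rewrite coord_mx_coords -!mulmxE.
have -> : map_mx const_morph g = map_mx phi (map_mx (fun c => c%:MP) g).
  by rewrite -map_mx_comp.
have -> : map_mx (fun c => c%:MP : P) (\adj g) = \adj (map_mx (fun c => c%:MP) g).
  pose mC : {rmorphism F -> P} := @mpolyC 16 F.
  by rewrite -[LHS]/(map_mx mC (\adj g)) map_mx_adj.
by rewrite -(map_mx_adj phi) -!map_mxM [LHS]mxE.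
Qed.

End Universal.

(** If the order were 0, the two weighted sums would agree, and dividing by p_0 p_1 p_2 would give
    e(M) = 0. *)
Lemma euler_order_gt0 (p : 'I_3 -> nat) (q : 'I_3 -> int) : (forall j, (0 < p j)%N) ->
  euler_number p q != 0 -> (0 < euler_order p (pos_part \o q) (neg_part \o q))%N.
Proof.
move=> p0; rewrite lt0n; apply: contra.
rewrite addn_eq0 !subn_eq0 -eqn_leq => /eqP w.
have qE j : (q j)%:~R = (pos_part (q j))%:R - (neg_part (q j))%:R :> rat.
  by case: (q j) => n /=; rewrite ?subr0 // NegzE rmorphN sub0r.
have pn0 j : (p j)%:R != 0 :> rat by rewrite pnatr_eq0 -lt0n.
have := congr1 (fun n => n%:R : rat) w.
rewrite /weighted /= !natrD !natrM => /eqP; rewrite -subr_eq0 => /eqP w0.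
rewrite /euler_number big_ord_recl big_ord_recl big_ord1.
have -> : lift ord0 ord0 = 1 :> 'I_3 by apply: val_inj.
have -> : lift ord0 (lift ord0 ord0) = 2 :> 'I_3 by apply: val_inj.
rewrite -[ord0]/(0 : 'I_3) !qE; apply/eqP.
set A0 := (pos_part _)%:R in w0 *; set B0 := (neg_part _)%:R in w0 *.
set A1 := (pos_part _)%:R in w0 *; set B1 := (neg_part _)%:R in w0 *.
set A2 := (pos_part _)%:R in w0 *; set B2 := (neg_part _)%:R in w0 *.
transitivity (0 / ((p 0)%:R * (p 1)%:R * (p 2)%:R) : rat); last by rewrite mul0r.
by rewrite -w0; field; rewrite !pn0.
Qed.

(** * Exceptional abelian characters, and the conclusion *)

Section Exceptional.
Variable F : numClosedFieldType.

Definition diag2 (x : F) : 'M[F]_2 :=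
  \matrix_(c, d) (if c == d then (if c == 0 then x else x^-1) else 0).

Lemma diag2M x y : diag2 x * diag2 y = diag2 (x * y).
Proof. by apply: matrix2P; rewrite !(mul2E, mxE) /= invfM; split; ring. Qed.

Lemma diag2_1 : diag2 1 = 1.
Proof. by apply: matrix2P; rewrite !mxE /= invr1. Qed.

Lemma diag2X x n : diag2 x ^+ n = diag2 (x ^+ n).
Proof.
by elim: n => [|n IH]; rewrite ?expr0 ?diag2_1 // !exprS IH diag2M.
Qed.

Lemma diag2_det x : x != 0 -> \det (diag2 x) = 1.
Proof. by move=> x0; rewrite det2E !mxE /= mulr0 subr0 divff. Qed.

Lemma diag2_adj x : \adj (diag2 x) = diag2 x^-1.
Proof.
rewrite adj2E tr2E; apply: matrix2P.
by rewrite !mxE /= ?mulr0n ?mulr1n invrK; split; ring.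
Qed.

Lemma diag2_inj x y : diag2 x = diag2 y -> x = y.
Proof. by move/matrixP/(_ 0 0); rewrite !mxE. Qed.

Lemma diag2_sign (eps : F) : eps ^+ 2 = 1 -> diag2 eps = 1 \/ diag2 eps = - 1.
Proof.
move/eqP; rewrite sqrf_eq1 => /orP[/eqP->|/eqP->]; first by left; exact: diag2_1.
by right; apply: matrix2P; rewrite !mxE /= invrN invr1 oppr0.
Qed.

Lemma exceptional_character (p : 'I_3 -> nat) (q : 'I_3 -> int) :
  exceptional_numbers F p (pos_part \o q) (neg_part \o q) ->
  has_exceptional_abelian_character F p q.
Proof.
move=> [eps [x [eps2 x012 xp xne]]].
have epsV : eps^-1 = eps.
  have eps0 : eps != 0 by apply: contra_eq_neq eps2 => ->; rewrite expr0n eq_sym oner_eq0.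
  by apply: (mulfI eps0); rewrite divff // -expr2 eps2.
pose rho (j : nat) : 'M[F]_2 := if insub j is Some k then diag2 (x k) else diag2 eps.
have rhoC (j : 'I_3) : rho j = diag2 (x j) by rewrite /rho valK.
have rhoH : rho 3 = diag2 eps by rewrite /rho insubF.
have x0 j : x j != 0.
  move: x012; apply: contra_eq_neq => xj.
  by case: (ord3P j) xj => -> ->; rewrite ?mul0r ?mulr0 ?mul0r eq_sym oner_eq0.
have eps0 : eps != 0 by apply: contra_eq_neq eps2 => ->; rewrite expr0n eq_sym oner_eq0.
have rep : is_rep p q rho.
  split.
  - by apply: coord_index_cases => [j|]; rewrite ?rhoC ?rhoH diag2_det.
  - by move=> j; rewrite rhoC rhoH mulmxE !diag2M mulrC.
  - move=> j; rewrite rhoC rhoH mulmxE diag2X -[1%:M]/(1 : 'M[F]_2) -diag2_1.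
    have := xp j; rewrite /=; case: (q j) => n /=.
      by rewrite expr0 diag2X diag2M => ->.
    rewrite expr0 mulr1 diag2_adj epsV diag2X diag2M => ->.
    by rewrite -expr2 exprAC eps2 expr1n.
  - rewrite (rhoC 0) (rhoC 1) (rhoC 2) !mulmxE !diag2M x012; exact: diag2_1.
(* The diagonal representation is itself exceptional, so it serves in both roles. *)
exists rho, rho; split=> //.
  split=> //; apply: coord_index_cases => [j|]; rewrite ?rhoC ?rhoH;
    by apply/is_diag_mxP => c d cd; rewrite mxE -val_eqE (negPf cd).
split=> //; first by rewrite rhoH; apply: diag2_sign.
move=> j; rewrite rhoC; split=> E; move: (xne j).
  by move: E; rewrite -[1%:M]/(1 : 'M[F]_2) -diag2_1 => /diag2_inj ->; rewrite expr1n eqxx.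
have /(congr1 (fun X : 'M_2 => X 0 0)) := E.
by rewrite !mxE /= => ->; rewrite sqrrN expr1n eqxx.
Qed.

End Exceptional.

Lemma character_scheme_reduced_of_no_exceptional (F : numClosedFieldType)
    (p : 'I_3 -> nat) (q : 'I_3 -> int) : (forall j, (0 < p j)%N) ->
  euler_number p q != 0 -> ~ has_exceptional_abelian_character F p q ->
  character_scheme_reduced F p q.
Proof.
move=> p0 e0 noexc f invf [n fn]; apply: boolp.contrapT => If.
have [B [phi [connB phiI phif]]] := connected_quotient_exists (in_ideal_is_ideal _) If.
apply: phif; have rep := universal_rep phiI.
have orb := invariant_on_orbits phiI invf.
have [c fc] : exists c, phi f = const_morph phi c.
  rewrite phi_mmap; have [] := dichotomy (const_morph phi) connB rep p0
    (euler_order_gt0 p0 e0) (fun ex => noexc (exceptional_character ex)).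
    exact: torus_constant.
  have [[dC _] _ _ C012] := rep.
  exact: irreducible_constant.
(* A power of [f] lies in the ideal, so the constant [c] is nilpotent in [B], hence zero. *)
have c0 : c = 0.
  apply: (@nilpotent_const F B (const_morph phi) c n).
  by rewrite -fc -rmorphXn; apply: phiI.
by rewrite fc c0 rmorph0.
Qed.

Theorem theorem5p9 (R : realType) (p : 'I_3 -> nat) (q : 'I_3 -> int) :
  (forall i, (0 < p i)%N) ->
  (forall i, coprime (p i) `|q i|%N) ->
  euler_number p q != 0 ->
  ~ has_exceptional_abelian_character (R[i])%C p q ->
  character_scheme_reduced (R[i])%C p q.
Proof.
move=> p0 _; exact: character_scheme_reduced_of_no_exceptional.
Qed.
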